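(* For every $n\ge 1$, there is a bijection between the set of rooted bicubic planar maps on $2n$ vertices and the set of Dyck paths of semilength $3n$ all of whose ascents have length a multiple of $3$, in which each ascent of length $3j$ is colored with one of $g_j$ colors, where $g_j$ is the number of 3-connected rooted bicubic planar maps on $2j$ vertices.
   Context: A rooted planar map is a 2-cell embedding of a connected graph in the sphere together with a distinguished directed root edge. A planar map is bicubic if it is 3-regular and bipartite. A Dyck path of semilength $m$ is a lattice path from $(0,0)$ to $(2m,0)$ with steps $(1,1)$ and $(1,-1)$ never going below the $x$-axis; an ascent is a maximal run of consecutive $(1,1)$ steps. The sequence $(g_j)_{j\ge1}$ begins $1,0,0,1,0,3,7,15,63,168,\dots$. In the colored paths, the colors of different ascents are chosen independently. *)

(* Defs.v *)
From mathcomp Require Import all_boot all_fingroup.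

Set Implicit Arguments.
Unset Strict Implicit.
Unset Printing Implicit Defensive.

(* A map on an oriented closed surface is encoded by its rotation system: the
   darts (directed edges) form the finite type [D], [vperm m] sends a dart to
   the next dart counterclockwise around its initial vertex, and [eperm m]
   reverses a dart.  [root m] is the root dart. *)
Definition rmap (D : finType) : Type := ({perm D} * {perm D} * D)%type.

Section RootedMaps.
Variable D : finType.
Implicit Types m : rmap D.

Definition vperm m : {perm D} := m.1.1.
Definition eperm m : {perm D} := m.1.2.
Definition root m : D := m.2.

Definition vertex m (x : D) : {set D} := porbit (vperm m) x.
Definition vertices m : {set {set D}} := porbits (vperm m).
Definition edges m : {set {set D}} := porbits (eperm m).
Definition faces m : {set {set D}} := porbits (eperm m * vperm m)%g.

Definition adjacent m (u v : {set D}) : bool :=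
  [exists x, (u == vertex m x) && (v == vertex m (eperm m x))].

(* Connectedness of the subgraph induced on a set [W] of vertices. *)
Definition connected_on m (W : {set {set D}}) : bool :=
  [forall u in W, forall v in W,
    connect [rel a b | [&& a \in W, b \in W & adjacent m a b]] u v].

(* For a connected map, Euler's formula characterizes the sphere. *)
Definition planar_map m : bool :=
  [&& [forall x, (eperm m x != x) && (eperm m (eperm m x) == x)],
      connected_on m (vertices m) &
      #|vertices m| + #|faces m| == #|edges m| + 2].

Definition cubic m : bool := [forall v in vertices m, #|v| == 3].

Definition bipartite m : bool :=
  [exists c : {ffun {set D} -> bool},
    [forall x, c (vertex m x) != c (vertex m (eperm m x))]].

Definition bicubic m : bool := cubic m && bipartite m.

(* No lower bound is put on the number of vertices: the map with two vertices
   joined by three parallel edges counts as 3-connected, so that g 1 = 1. *)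
Definition three_connected m : bool :=
  [forall S : {set {set D}}, (S \subset vertices m) && (#|S| < 3) ==>
    connected_on m (vertices m :\: S)].

(* Rooted maps are identified up to orientation-preserving isomorphism, i.e. up
   to relabelling of the darts. *)
Definition isomorphic m1 m2 : bool :=
  [exists h : {perm D},
    [&& [forall x, h (vperm m1 x) == vperm m2 (h x)],
        [forall x, h (eperm m1 x) == eperm m2 (h x)] &
        h (root m1) == root m2]].

Lemma cubic_card m : cubic m -> #|D| = 3 * #|vertices m|.
Proof.
move=> /forall_inP cm.
have part : partition (vertices m) [set: D].
  have -> : vertices m =
      equivalence_partition (fun x y => y \in porbit (vperm m) x) [set: D].
    apply/setP=> A; apply/imsetP/imsetP => -[x _ ->]; exists x => //;
      by apply/setP=> y; rewrite !inE.
  apply: equivalence_partitionP => x y z _ _ _; split; first exact: porbit_id.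
  by rewrite -eq_porbit_mem => /eqP ->.
rewrite -cardsT (card_partition part) mulnC -sum_nat_const.
by apply: eq_bigr => v /cm /eqP.
Qed.

End RootedMaps.

(* By [cubic_card], a cubic map on 2n vertices has 6n darts, so that every
   rooted bicubic planar map on 2n vertices can be labelled by 'I_(6 * n). *)
Definition labelled_bicubic (n : nat) : {set rmap 'I_(6 * n)} :=
  [set m | [&& planar_map m, bicubic m & #|vertices m| == 2 * n]].

Definition bicubic_maps (n : nat) : {set {set rmap 'I_(6 * n)}} :=
  equivalence_partition (@isomorphic _) (labelled_bicubic n).

Definition bicubic_maps3 (n : nat) : {set {set rmap 'I_(6 * n)}} :=
  equivalence_partition (@isomorphic _)
    [set m in labelled_bicubic n | three_connected m].

Definition g (j : nat) : nat := #|bicubic_maps3 j|.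

(* A lattice path is its sequence of steps, [true] for (1,1) and [false] for
   (1,-1). *)
Definition dyck (m : nat) (w : seq bool) : bool :=
  [&& size w == 2 * m,
      count_mem true w == count_mem false w &
      all (fun k => count_mem false (take k w) <= count_mem true (take k w))
          (iota 0 (size w).+1)].

(* The lengths of the ascents of a path from left to right; an ascent starts at
   an up-step that is first or follows a down-step. *)
Definition ascents (w : seq bool) : seq nat :=
  [seq index false (drop i w) |
     i <- iota 0 (size w) & nth false w i && ~~ nth false (false :: w) i].

(* A coloring is the list of the colors of the ascents from left to right, the
   colors available to an ascent of length 3j being 0, ..., g j - 1. *)
Definition colored_dyck (n : nat) (p : seq bool * seq nat) : bool :=
  [&& dyck (3 * n) p.1,
      all (dvdn 3) (ascents p.1) &
      all2 (fun a c => c < g (a %/ 3)) (ascents p.1) p.2].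

(* Main.v *)
(* A bipartite cubic map is a pair of permutations (a, b) of its edges, all of
   whose cycles have length 3.  Exchanging the white ends of the two edges of a
   2-edge cut splits a map into two, and the inverse operation inserts a map
   rooted at r into an edge k; Euler's inequality, together with the fact that
   cubic bipartite graphs have no bridge, shows that a map is planar if and only
   if both parts are.  Maximal 2-edge cuts away from the root are disjoint, so a
   rooted map is a 3-connected core with 3j edges, each carrying a possibly empty
   rooted map.  Counting pairs (map, edge of the core carrying a nonempty map) in
   two ways gives, for the generating function C of rooted maps with constant
   term 1, the equation C = 1 + sum_j g_j (X C^3)^j, which determines C.
   Multiplied by C^h it becomes the recurrence for coloured paths that start at
   height h with a down-step or an ascent of length 3j. *)

Require Import Defs.
From mathcomp Require Import all_boot all_fingroup all_algebra zify.

Set Implicit Arguments.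
Unset Strict Implicit.
Unset Printing Implicit Defensive.

(** * Nonnegativity of the genus *)

(** The bijection is obtained from equality of two cardinalities. Binomial coefficients absorb the
    choice of [X], and the factorials cancel at the end. Edges suffice instead of darts because
    black can be taken as the colour of the root vertex, so that the root is just an edge. A part of
    a map lives on a subset [U] of the same type [T], which avoids changing types when a map is cut.

    Graph-theoretic arguments are replaced by two facts about permutations. The first is the Euler
    inequality, valid for arbitrary pairs. The second is a congruence: the edges with black end in a
    given set of vertices are 3 times as many as its black vertices, and likewise for white, so the
    two kinds of boundary edges of a set agree in number modulo 3. This yields the absence of
    bridges, the size of small cuts, and the passage between vertex cuts and edge cuts. *)

Section Closed.
Variable T : finType.
Implicit Types (a b s t : {perm T}) (X Y Z U R : {set T}).

Definition closed_under a X : bool := [forall x, (a x \in X) == (x \in X)].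

Lemma closed_underP a X :
  reflect (forall x, (a x \in X) = (x \in X)) (closed_under a X).
Proof. by apply: (iffP forallP) => h x; apply/eqP; rewrite ?(eqP (h x)) ?h. Qed.

Lemma closed_underU a X Y :
  closed_under a X -> closed_under a Y -> closed_under a (X :|: Y).
Proof.
move=> /closed_underP hX /closed_underP hY; apply/closed_underP=> x.
by rewrite !inE hX hY.
Qed.

Lemma closed_underI a X Y :
  closed_under a X -> closed_under a Y -> closed_under a (X :&: Y).
Proof.
move=> /closed_underP hX /closed_underP hY; apply/closed_underP=> x.
by rewrite !inE hX hY.
Qed.

Lemma closed_underC a X : closed_under a X -> closed_under a (~: X).
Proof. by move=> /closed_underP hX; apply/closed_underP=> x; rewrite !inE hX. Qed.

Lemma closed_underD a X Y :
  closed_under a X -> closed_under a Y -> closed_under a (X :\: Y).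
Proof. by move=> hX hY; rewrite setDE; apply: closed_underI => //; apply: closed_underC. Qed.

Lemma closed_underT a : closed_under a setT.
Proof. by apply/closed_underP=> x; rewrite !inE. Qed.

Lemma closed_underM a b X :
  closed_under a X -> closed_under b X -> closed_under (a * b) X.
Proof.
move=> /closed_underP hX /closed_underP hY; apply/closed_underP=> x.
by rewrite permM hY hX.
Qed.

(** By finiteness, an injection of [X] into itself is onto. *)
Lemma closed_under_sub a X : (forall x, x \in X -> a x \in X) -> closed_under a X.
Proof.
move=> h; have e : [set a x | x in X] = X.
  apply/eqP; rewrite eqEcard card_imset ?leqnn ?andbT; last exact: perm_inj.
  by apply/subsetP=> _ /imsetP[x /h ? ->].
apply/closed_underP=> x; apply/idP/idP=> [|/h //].
by rewrite -{1}e => /imsetP[y ? /perm_inj ->].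
Qed.

Lemma closed_under_porbit a x : closed_under a (porbit a x).
Proof.
apply: closed_under_sub => y hy; rewrite -(eqP (_ : porbit a y == porbit a x)).
  by rewrite (mem_porbit a 1).
by rewrite eq_porbit_mem.
Qed.

Lemma porbit_subset a X x : closed_under a X -> x \in X -> porbit a x \subset X.
Proof.
move=> /closed_underP h xX; apply/subsetP=> _ /porbitP[i ->].
by elim: i => [|i IH]; rewrite ?perm1 // expgSr permM h.
Qed.

Lemma eq_porbit_on s t X x :
  closed_under s X -> closed_under t X -> {in X, s =1 t} -> x \in X -> porbit s x = porbit t x.
Proof.
move=> hs ht st xX; apply/setP=> y.
suff e i : (s ^+ i)%g x = (t ^+ i)%g x.
  by apply/porbitP/porbitP=> -[i ->]; exists i.
elim: i => [|i IH]; first by rewrite !expg0.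
rewrite !expgSr !permM IH st //; have /subsetP := porbit_subset ht xX.
by apply; apply: mem_porbit.
Qed.

Lemma porbit_conj s t x : porbit (s ^ t) (t x) = t @: porbit s x.
Proof.
apply/setP=> y; apply/porbitP/imsetP=> [[i ->]|[z /porbitP[i ->] ->]].
  by exists ((s ^+ i)%g x); rewrite ?mem_porbit // -conjXg permJ.
by exists i; rewrite -conjXg permJ.
Qed.

Lemma porbits_conj s t : #|porbits (s ^ t)| = #|porbits s|.
Proof.
have -> : porbits (s ^ t) = (fun A : {set T} => t @: A) @: porbits s.
  apply/setP=> A; apply/imsetP/imsetP=> [[x _ ->]|[_ /imsetP[x _ ->] ->]].
    by exists (porbit s ((t^-1)%g x)); rewrite ?imset_f // -porbit_conj permKV.
  by exists (t x); rewrite ?porbit_conj.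
by rewrite card_imset //; apply: imset_inj; apply: perm_inj.
Qed.

Lemma porbits_tpermr s x y :
  #|porbits (s * tperm x y)| = #|porbits (tperm x y * s)|.
Proof. by rewrite -(porbits_conj _ (tperm x y)) conjgE tpermV -!mulgA tperm2 mulg1. Qed.

(** [R] meets every component of the pair, so [#|R|] is an upper bound for the number of components;
    it stands in for that number in the Euler inequality. *)
Definition hits a b R :=
  forall Z, closed_under a Z -> closed_under b Z -> Z != set0 -> Z :&: R != set0.

Lemma closed_under_tperm b x y Z :
  (x \in Z) = (y \in Z) -> closed_under b Z -> closed_under (tperm x y * b) Z.
Proof.
move=> xy hb; apply: closed_underM => //; apply/closed_underP=> z.
by case: tpermP => [->|->|//]; rewrite xy.
Qed.

(** Removing a transposition can only break one component into a piece containing [x] and a piece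
    containing [y]. If one piece misses [R], adding its point to [R] repairs this. The separating
    set is kept because it also forces [x] and [y] into different faces. *)
Lemma hits_untperm a b x y R : hits a (tperm x y * b) R ->
  hits a b R \/
  (exists2 z, hits a b (z |: R) &
    exists Z, [/\ closed_under a Z, closed_under b Z, x \in Z & y \notin Z]).
Proof.
move=> hR.
have key z w : [set z; w] = [set x; y] -> forall Z0, closed_under a Z0 -> closed_under b Z0 ->
    z \in Z0 -> w \notin Z0 -> Z0 :&: R == set0 -> hits a b (z |: R).
  move=> zw Z0 az bz zZ wZ ZR Z aZ bZ Z0N.
  have [zZ'|zZ'] := boolP (z \in Z).
    by apply/set0Pn; exists z; rewrite !inE zZ' eqxx.
  (* If [w] is in [Z], then [Z :|: Z0] contains both points; otherwise [Z] contains neither. That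
     set is closed for the pair with the transposition, so [R] meets it, and does so outside
     [Z0]. *)
  have xy : (x \in Z :|: Z0) = (y \in Z :|: Z0) \/ (x \in Z) = (y \in Z).
    move/setP: (zw) => zw'; have := zw' x; have := zw' y; rewrite !inE !eqxx orbT /=.
    have [wZ'|wZ'] := boolP (w \in Z).
      by move=> /orP[/eqP->|/eqP->] /orP[/eqP->|/eqP->]; left; rewrite ?zZ ?wZ' ?orbT.
    by move=> /orP[/eqP->|/eqP->] /orP[/eqP->|/eqP->]; right; rewrite ?(negbTE zZ') ?(negbTE wZ').
  have sub V : V :&: R != set0 -> V :&: (z |: R) != set0.
    by move=> /set0Pn[v]; rewrite inE => /andP[vV vR]; apply/set0Pn; exists v; rewrite !inE vV vR orbT.
  case: xy => xy.
    have h0 : Z :|: Z0 != set0.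
      by case/set0Pn: Z0N => v vZ; apply/set0Pn; exists v; rewrite inE vZ.
    have := hR _ (closed_underU aZ az) (closed_under_tperm xy (closed_underU bZ bz)) h0.
    by rewrite setIUl (eqP ZR) setU0; apply: sub.
  by apply: sub; apply: hR => //; apply: closed_under_tperm.
pose P z w := [exists Z, [&& closed_under a Z, closed_under b Z, z \in Z, w \notin Z & Z :&: R == set0]].
have [/existsP[Z /and5P[aZ bZ xZ yZ ZR]]|/existsPn Nx] := boolP (P x y).
  by right; exists x; [apply: (key x y) ZR | exists Z].
have [/existsP[Z /and5P[aZ bZ xZ yZ ZR]]|/existsPn Ny] := boolP (P y x).
  right; exists y; first by apply: (key y x) ZR => //; rewrite setUC.
  by exists (~: Z); rewrite !inE xZ; split=> //; apply: closed_underC.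
left=> Z aZ bZ Z0; apply/negP=> ZR.
have := Nx Z; have := Ny Z; rewrite aZ bZ ZR /= !andbT.
case: (boolP (x \in Z)) => xZ; case: (boolP (y \in Z)) => yZ //= _ _.
  by move: (hR Z aZ (closed_under_tperm (etrans xZ (esym yZ)) bZ) Z0); rewrite ZR.
have e : (x \in Z) = (y \in Z) by rewrite (negbTE xZ) (negbTE yZ).
by move: (hR Z aZ (closed_under_tperm e bZ) Z0); rewrite ZR.
Qed.

Lemma porbits1 : #|porbits (1 : {perm T})| = #|T|.
Proof.
rewrite card_imset ?cardsT // => x y /setP/(_ x).
by rewrite porbit_id => /esym/porbitP[i]; rewrite expg1n perm1.
Qed.

(* Nonnegativity of the genus, in the form V + E + F <= n + 2c for c components:
   splitting fixed points off the cycles of [b] one at a time never increases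
   n + 2c - V - E - F, which vanishes at [b = 1]. *)
Lemma euler_inequality a b R : hits a b R ->
  #|porbits a| + #|porbits b| + #|porbits (b * a)| <= #|T| + 2 * #|R|.
Proof.
have [m] := ubnP #|[set x | b x != x]|; elim: m b R => // m IH b R lem hR.
have [/set0Pn[x]|b1] := boolP ([set x | b x != x] != set0); last first.
  have {b1} b1 : b = 1%g.
    apply/permP=> x; rewrite perm1; apply/eqP/negPn/negP=> bx.
    by move: b1; rewrite negbK => /eqP/setP/(_ x); rewrite !inE bx.
  rewrite b1 mul1g porbits1.
  suff : #|porbits a| <= #|R| by lia.
  have sub : porbits a \subset (porbit a) @: R.
    apply/subsetP=> _ /imsetP[x _ ->].
    have /set0Pn[y] : porbit a x :&: R != set0.
      apply: hR; first exact: closed_under_porbit.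
        by apply/closed_underP=> y; rewrite b1 perm1.
      by apply/set0Pn; exists x; apply: porbit_id.
    by rewrite inE => /andP[yx yR]; apply/imsetP; exists y => //; apply/esym/eqP; rewrite eq_porbit_mem.
  exact: leq_trans (subset_leq_card sub) (leq_imset_card _ _).
rewrite inE => bx.
(* Composing [b] with the transposition of [x] and its predecessor makes [x] a fixed point and
   shortens its cycle by one. *)
pose y := (b^-1)%g x; have by_ : b y = x by rewrite permKV.
have xy : x != y by apply: contraNneq bx => e; rewrite {1}e by_ .
pose t := tperm x y; pose b0 := (t * b)%g.
have eb : b = (t * b0)%g by rewrite /b0 mulgA tperm2 mul1g.
have b0x : b0 x = x by rewrite permM tpermL.
have nxy : x \notin porbit b0 y.
  rewrite porbit_sym; apply/porbitP=> -[i].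
  have -> : (b0 ^+ i)%g x = x by elim: i => [|i IHi]; rewrite ?perm1 // expgSr permM IHi.
  by move=> /esym/eqP; rewrite (negbTE xy).
have l0 : #|[set z | b0 z != z]| < m.
  have : [set z | b0 z != z] \proper [set z | b z != z].
    apply/properP; split; last by exists x; rewrite !inE ?b0x ?eqxx.
    apply/subsetP=> z; rewrite !inE; apply: contra => /eqP bz.
    rewrite permM; case: tpermP => [e|e|_ _]; rewrite ?by_ ?bz //.
      by rewrite e in bz; rewrite bz eqxx in bx.
    by move: bz xy; rewrite e by_ => ->; rewrite eqxx.
  by move/proper_card; lia.
have hR0 : hits a (tperm x y * b0)%g R by rewrite -/t -eb.
have e1 : #|porbits (b * a)| + (x \notin porbit (b0 * a) y).*2 = #|porbits (b0 * a)| + 1.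
  by have := porbits_mul_tperm (b0 * a)%g x y; rewrite /= mulgA -/t -eb xy.
have e2 : #|porbits b| + 2 = #|porbits b0| + 1.
  by have := porbits_mul_tperm b0 x y; rewrite /= -/t -eb nxy xy.
case: (hits_untperm hR0) => [h|[z h [Z [aZ bZ xZ yZ]]]].
  have := IH _ _ l0 h; case: (x \notin _) e1; lia.
have := IH _ _ l0 h.
(* Since [Z] separates [x] from [y], the product [b0 * a] has one cycle more than [b * a]. With the
   additional cycle of [b0] this pays for the point added to [R], which costs 2. *)
have nxy' : x \notin porbit (b0 * a)%g y.
  rewrite porbit_sym; have /subsetP sub := porbit_subset (closed_underM bZ aZ) xZ.
  by apply: contra yZ; apply: sub.
have := cardsU1 z R; move: e1; rewrite nxy'; case: (z \notin R); lia.
Qed.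

End Closed.

(** * Two-edge cuts *)

Section Cuts.
Variable T : finType.
Implicit Types (a b s t : {perm T}) (X Y Z W U R : {set T}) (x k r rho : T).

Definition cubic_on U a : bool := [forall x in U, #|porbit a x| == 3].

Definition transitive_on U a b : bool :=
  [&& closed_under a U, closed_under b U &
    [forall Z : {set T},
      [&& closed_under a Z, closed_under b Z, Z \subset U & Z != set0] ==> (Z == U)]].

(* A set of vertices is given by the set [X] of edges with black end in it and
   the set [Y] of edges with white end in it; the edges leaving it are those of
   [X :\: Y] and [Y :\: X].  Here it is one side of a 2-edge cut, the side that
   does not contain the black end of the root. *)
Definition away U a b rho X Y : bool :=
  [&& X \subset U, Y \subset U, closed_under a X, closed_under b Y, rho \notin X,
      #|X :\: Y| == 1 & #|Y :\: X| == 1].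

(* The edges with black end in the 3-connected component of the root.  They are
   the edges of that component: the white end of a core edge in [slots] lies in
   the map substituted there, that of any other core edge in the component. *)
Definition core U a b rho : {set T} :=
  [set x in U | [forall X : {set T}, forall Y : {set T}, away U a b rho X Y ==> (x \notin X)]].

Definition slots U a b rho : {set T} :=
  [set k in core U a b rho | [exists X : {set T}, exists Y : {set T},
     away U a b rho X Y && (k \in Y)]].

(** Lets inequalities between numbers of boundary edges be verified one edge at a time, with
    multiplicity. *)
Lemma leq_cards2 (A B C D : {set T}) :
  (forall x, (x \in A) + (x \in B) <= (x \in C) + (x \in D)) ->
  #|A| + #|B| <= #|C| + #|D|.
Proof.
move=> h; rewrite -!sum1_card !(big_mkcond (fun i => i \in _)) /= -!big_split /=.
by apply: leq_sum => x _; have := h x; do 4!case: (_ \in _).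
Qed.

Lemma cubic_onS U U' a : U' \subset U -> cubic_on U a -> cubic_on U' a.
Proof. by move=> /subsetP s /forall_inP h; apply/forall_inP=> x /s; apply: h. Qed.

Definition ncycles U s : nat := #|porbit s @: U|.

Lemma card_closed_ncycles U a X : cubic_on U a -> closed_under a X -> X \subset U ->
  #|X| = 3 * ncycles X a.
Proof.
move=> /forall_inP ca aX /subsetP sub.
have part : partition (equivalence_partition (fun x y => y \in porbit a x) X) X.
  apply: equivalence_partitionP => x y z _ _ _; split; first exact: porbit_id.
  by rewrite -eq_porbit_mem => /eqP ->.
have eP : equivalence_partition (fun x y => y \in porbit a x) X = porbit a @: X.
  apply: eq_in_imset => x xX; apply/setP=> y; rewrite inE andb_idl //.
  by apply/subsetP/porbit_subset.
rewrite eP in part; rewrite (card_uniform_partition (n := 3) _ part) 1?mulnC //.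
by move=> A /imsetP[x xX ->]; apply/eqP/ca/sub.
Qed.

Lemma card_closed U a X : cubic_on U a -> closed_under a X -> X \subset U -> 3 %| #|X|.
Proof. by move=> ca aX sub; rewrite (card_closed_ncycles ca aX sub) dvdn_mulr. Qed.

Lemma closed_under_tpermP b k r Z : k \notin Z -> r \notin Z ->
  closed_under (b ^ tperm k r) Z = closed_under b Z.
Proof.
move=> kZ rZ; have e x : (tperm k r x \in Z) = (x \in Z).
  by case: tpermP => [->|->|//]; rewrite (negbTE kZ) (negbTE rZ).
apply/closed_underP/closed_underP => h x.
  by have := h (tperm k r x); rewrite permJ !e.
by rewrite -{1}(tpermK k r x) permJ e h e.
Qed.

Section Rooted.
Variables (U : {set T}) (a b : {perm T}) (rho : T).
Hypotheses (cU : transitive_on U a b) (ca : cubic_on U a) (cb : cubic_on U b) (rU : rho \in U).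
Local Notation awayU := (away U a b rho).

(** Both [#|X|] and [#|Y|] are multiples of 3, so the two differences are congruent modulo 3, hence
    equal as both are at most 2, hence at most 1. They cannot vanish: [X = Y] would be closed under
    both rotations without containing [rho], against connectedness. *)
Lemma small_boundary X Y : X \subset U -> Y \subset U ->
  closed_under a X -> closed_under b Y -> rho \notin X ->
  (X != set0) || (Y != set0) ->
  #|X :\: Y| <= 2 -> #|Y :\: X| <= 2 -> #|X :\: Y| + #|Y :\: X| <= 3 -> awayU X Y.
Proof.
move=> XU YU aX bY rX X0 l1 l2 l3; rewrite /away XU YU aX bY rX.
have /dvdnP[i hi] := card_closed ca aX XU; have /dvdnP[j hj] := card_closed cb bY YU.
have := cardsID Y X; have := cardsID X Y; rewrite (setIC Y X) hi hj => e1 e2.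
have eq12 : #|X :\: Y| = #|Y :\: X| by move: e1 e2 l1 l2; clear; lia.
have [z|nz] := eqVneq #|X :\: Y| 0; last first.
  by move: nz l3; rewrite -eq12; clear; case: #|_| => [|[|]] //; lia.
have z' : #|Y :\: X| = 0 by rewrite -eq12.
have XY : X = Y.
  by apply/eqP; rewrite eqEsubset -!setD_eq0 -!cards_eq0 z z' eqxx.
case/and3P: cU => _ _ /forallP/(_ X); rewrite aX XY bY YU /=.
by move: X0; rewrite XY orbb => -> /eqP e; rewrite XY e rU in rX.
Qed.

Lemma away_card X Y : awayU X Y -> #|X| = #|Y|.
Proof.
case/and5P=> _ _ _ _ /and3P[_ /eqP h1 /eqP h2].
by rewrite -(cardsID Y X) -(cardsID X Y) h1 h2 setIC.
Qed.

Lemma away_neq0 X Y : awayU X Y -> (X != set0) /\ (Y != set0).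
Proof.
by case/and5P=> _ _ _ _ /and3P[_ /eqP h1 /eqP h2]; split;
  apply/eqP=> e; [move: h1 | move: h2]; rewrite e set0D cards0.
Qed.

(* Submodularity: if [X] and [Z] meet, their intersection has at least one
   boundary edge; otherwise each edge of the overlap is a boundary edge of one of
   the two sets that the union absorbs.  Either way at most 3 of the 4 boundary
   edges survive, and divisibility by 3 leaves exactly 2. *)
Lemma away_setU X Y Z W : awayU X Y -> awayU Z W ->
  ~~ [disjoint X :|: Y & Z :|: W] -> awayU (X :|: Z) (Y :|: W).
Proof.
move=> h1 h2 ov; have [X0 Y0] := away_neq0 h1.
case/and5P: h1 => XU YU aX bY /and3P[rX /eqP n1 /eqP n2].
case/and5P: h2 => ZU WU aZ bW /and3P[rZ /eqP n3 /eqP n4].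
have le1 : #|(X :|: Z) :\: (Y :|: W)| <= 2.
  have := @leq_cards2 ((X :|: Z) :\: (Y :|: W)) set0 (X :\: Y) (Z :\: W).
  rewrite cards0 n3 n1 addn0; apply=> x; rewrite !inE.
  by do 4!case: (x \in _).
have le2 : #|(Y :|: W) :\: (X :|: Z)| <= 2.
  have := @leq_cards2 ((Y :|: W) :\: (X :|: Z)) set0 (Y :\: X) (W :\: Z).
  rewrite cards0 n2 n4 addn0; apply=> x; rewrite !inE.
  by do 4!case: (x \in _).
apply: small_boundary => //; rewrite ?subUset ?XU ?YU ?closed_underU //.
- by rewrite inE negb_or rX rZ.
- by rewrite setU_eq0 negb_and X0.
set A := (X :|: Z) :\: _ in le1 *; set B := (Y :|: W) :\: _ in le2 *.
have cb1 : #|(X :\: Y) :|: (Y :\: X)| = 2.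
  by rewrite cardsU n1 n2 (_ : _ :&: _ = set0) ?cards0 //;
     apply/setP=> x; rewrite !inE; do 2!case: (x \in _).
have cb2 : #|(Z :\: W) :|: (W :\: Z)| = 2.
  by rewrite cardsU n3 n4 (_ : _ :&: _ = set0) ?cards0 //;
     apply/setP=> x; rewrite !inE; do 2!case: (x \in _).
have cAB : #|A| + #|B| = #|A :|: B|.
  by rewrite cardsU (_ : _ :&: _ = set0) ?cards0 ?subn0 //;
     apply/setP=> x; rewrite !inE; do 4!case: (x \in _).
suff [C C0 hC] : exists2 C : {set T}, C != set0 &
    forall x, (x \in A :|: B) + (x \in C) <=
      (x \in (X :\: Y) :|: (Y :\: X)) + (x \in (Z :\: W) :|: (W :\: Z)).
  by have := leq_cards2 hC; rewrite cAB cb1 cb2; move: C0; rewrite -card_gt0; clear; lia.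
have [XZ|XZ] := eqVneq (X :&: Z) set0.
  exists ((X :|: Y) :&: (Z :|: W)); first by rewrite setI_eq0.
  move=> x; rewrite !inE; move/setP/(_ x): XZ; rewrite !inE.
  by do 4!case: (x \in _).
exists (((X :&: Z) :\: (Y :&: W)) :|: ((Y :&: W) :\: (X :&: Z))); last first.
  by move=> x; rewrite !inE; do 4!case: (x \in _).
(* An intersection without boundary edge is closed under both rotations, hence is all of [U]; but it
   misses [rho]. *)
apply/eqP=> e; have eI : X :&: Z = Y :&: W.
  by apply/setP=> x; move/setP/(_ x): e; rewrite !inE; do 4!case: (x \in _).
case/and3P: cU => _ _ /forallP/(_ (X :&: Z)).
rewrite closed_underI //= {1}eI closed_underI //= subIset ?XU //= XZ => /eqP e'.
by have := rU; rewrite -e' inE (negbTE rX).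
Qed.

Definition max_away X Y := awayU X Y /\ forall Z W, awayU Z W ->
  (Z \subset X) /\ (W \subset Y) \/ [disjoint X :|: Y & Z :|: W].

(** The union of the two pairs is again [away] with the same first component, and in such a pair
    both components have the same size. *)
Lemma away_uniq X Y W : awayU X Y -> awayU X W -> W \subset Y.
Proof.
move=> h1 h2; have [X0 _] := away_neq0 h1.
have h : awayU (X :|: X) (Y :|: W).
  apply: away_setU => //; rewrite -setI_eq0; case/set0Pn: X0 => x xX.
  by apply/set0Pn; exists x; rewrite !inE xX.
have e : Y :|: W = Y.
  apply/eqP; rewrite eq_sym eqEcard subsetUl /=.
  by rewrite -(away_card h1) -(away_card h) setUid.
by apply/setUidPl.
Qed.

Lemma max_away_exists X0 Y0 : awayU X0 Y0 ->
  exists X Y, [/\ max_away X Y, X0 \subset X & Y0 \subset Y].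
Proof.
move=> h0; pose P X := [exists Y : {set T}, awayU X Y].
have PX0 : P X0 by apply/existsP; exists Y0.
have [X /maxsetP[/existsP[Y hXY] mX] X0X] := maxset_exists PX0.
have key Z W : awayU Z W -> (Z \subset X) /\ (W \subset Y) \/ [disjoint X :|: Y & Z :|: W].
  move=> h; have [d|d] := boolP [disjoint X :|: Y & Z :|: W]; [by right | left].
  have hU := away_setU hXY h d.
  have eX : X :|: Z = X by apply: mX (subsetUl _ _); apply/existsP; exists (Y :|: W).
  split; first by apply/setUidPl.
  rewrite eX in hU; apply: subset_trans (away_uniq hXY hU); exact: subsetUr.
exists X, Y; split=> //.
case: (key _ _ h0) => [[]//|]; rewrite -setI_eq0 => /eqP/setP.
case/away_neq0: (h0) => /set0Pn[x xX0] _ /(_ x); rewrite !inE xX0.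
by rewrite (subsetP X0X).
Qed.

(** A pair containing the black end of [k] would overlap the maximal one at [k], hence be nested in
    it, although the black end of [k] is outside [X]. *)
Lemma max_away_core X Y k : max_away X Y -> k \in Y :\: X -> k \in core U a b rho.
Proof.
case=> h mx; rewrite !inE => /andP[kX kY].
case/and3P: (h) => _ /subsetP YU _; rewrite (YU k) //=.
apply/forallP=> Z; apply/forallP=> W; apply/implyP=> hZ.
case: (mx _ _ hZ) => [[/subsetP ZX _]|]; first by apply: contra kX; apply: ZX.
rewrite -setI_eq0 => /eqP/setP/(_ k); rewrite !inE kY orbT /=.
by move/negbT; rewrite negb_or => /andP[].
Qed.

Lemma slots_core k : k \in slots U a b rho -> k \in core U a b rho.
Proof. by rewrite inE => /andP[]. Qed.

Lemma core_away k X Y : k \in core U a b rho -> awayU X Y -> k \notin X.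
Proof. by rewrite inE => /andP[_ /forallP/(_ X)/forallP/(_ Y)/implyP]; apply. Qed.

(** Identifies slots with maximal cuts: each maximal cut has one edge whose black end is on the root
    side, and that edge is the slot. By [max_away_inj] the slot determines the cut. *)
Lemma slotsP k : reflect (exists X Y, max_away X Y /\ k \in Y :\: X) (k \in slots U a b rho).
Proof.
apply: (iffP idP) => [h|[X [Y [h kY]]]].
  have kc := slots_core h; move: h; rewrite inE => /andP[_ /existsP[X0 /existsP[Y0 /andP[h0 kY0]]]].
  have [X [Y [h _ /subsetP sY]]] := max_away_exists h0; exists X, Y; split=> //.
  by rewrite inE (core_away kc (proj1 h)) (sY _ kY0).
rewrite inE (max_away_core h kY); apply/existsP; exists X; apply/existsP; exists Y.
by rewrite (proj1 h); case/setDP: kY.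
Qed.

Lemma max_away_inj X Y X' Y' k : max_away X Y -> max_away X' Y' ->
  k \in Y -> k \in Y' -> X = X' /\ Y = Y'.
Proof.
move=> [h1 m1] [h2 m2] kY kY'.
have d : [disjoint X :|: Y & X' :|: Y'] = false.
  by apply/negbTE; rewrite -setI_eq0; apply/set0Pn; exists k; rewrite !inE kY kY' !orbT.
case: (m1 _ _ h2) => [[s1 s2]|]; last by rewrite d.
case: (m2 _ _ h1) => [[s3 s4]|]; last by rewrite disjoint_sym d.
by split; apply/eqP; rewrite eqEsubset ?s1 ?s2 ?s3 ?s4.
Qed.

Lemma slots0_away : slots U a b rho = set0 -> forall X Y, ~~ awayU X Y.
Proof.
move=> e X Y; apply/negP=> /max_away_exists[Z [W [h _ _]]].
case/and5P: (proj1 h) => _ _ _ _ /and3P[_ _ /cards1P[k ek]].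
suff : k \in slots U a b rho by rewrite e inE.
by apply/slotsP; exists Z, W; rewrite ek inE eqxx.
Qed.

Lemma root_core : rho \in core U a b rho.
Proof.
rewrite inE rU; apply/forallP=> X; apply/forallP=> Y; apply/implyP.
by case/and5P=> _ _ _ _ /andP[].
Qed.

(** Membership in the core depends only on the black end of an edge, so the core is closed under
    [a]. *)
Lemma core_card : 3 %| #|core U a b rho|.
Proof.
apply: (card_closed ca); last by apply/subsetP=> x; rewrite inE => /andP[].
case/and3P: cU => /closed_underP aU _ _.
apply/closed_underP=> x; rewrite !inE aU; congr (_ && _).
apply: eq_forallb => X; apply: eq_forallb => Y; apply: implyb_id2l.
by case/and5P=> _ _ /closed_underP -> _ _.
Qed.

End Rooted.
End Cuts.

(** * Planarity across a cut *)

Section Planarity.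
Variable T : finType.
Implicit Types (a b s t : {perm T}) (X Y Z W U R : {set T}) (x k r rho : T).

(** Euler's formula for a connected map: the three summands count black vertices, white vertices and
    faces, and [#|U|] counts edges. *)
Definition planar_on U a b : bool :=
  ncycles U a + ncycles U b + ncycles U (b * a) == #|U| + 2.

Lemma ncycles_setT s : ncycles [set: T] s = #|porbits s|.
Proof. by apply: eq_card => A; apply/imsetP/imsetP=> -[x _ ->]; exists x. Qed.

Lemma ncyclesC U s : closed_under s U -> ncycles U s + ncycles (~: U) s = #|porbits s|.
Proof.
move=> sU; rewrite -ncycles_setT /ncycles -(setUCr U) imsetU cardsU.
rewrite (_ : _ :&: _ = set0) ?cards0 ?subn0 //; apply/setP=> A; rewrite in_set0.
apply/negP=> /setIP[/imsetP[x xU ->] /imsetP[y yU e]].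
have := subsetP (porbit_subset sU xU) y; rewrite e porbit_id => /(_ isT).
by move: yU; rewrite inE => /negbTE ->.
Qed.

Lemma eq_ncycles U s t : closed_under s U -> {in U, s =1 t} -> ncycles U s = ncycles U t.
Proof.
move=> sU st; have tU : closed_under t U.
  by apply: closed_under_sub => x xU; rewrite -st // (closed_underP _ _ sU).
congr #|pred_of_set _|; apply: eq_in_imset => x xU; exact: eq_porbit_on st xU.
Qed.

Lemma porbits_restrict U s t : closed_under t U -> {in U, s =1 t} -> {in ~: U, forall x, s x = x} ->
  #|porbits s| = ncycles U t + #|~: U|.
Proof.
move=> tU st sid; have sU : closed_under s U.
  by apply: closed_under_sub => x xU; rewrite st // (closed_underP _ _ tU).
rewrite -(ncyclesC sU) (eq_ncycles sU st); congr (_ + _).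
rewrite /ncycles card_in_imset // => x y xU yU /setP/(_ x); rewrite porbit_id => /esym/porbitP[i ->].
by elim: i => [|i IH]; rewrite ?perm1 // expgSr permM IH sid.
Qed.

Lemma closed_norm U s : closed_under s U -> s \in 'N(U | 'P)%g.
Proof. by move=> /closed_underP h; apply/astabsP=> x; apply: h. Qed.

Lemma restr_permE_closed U s : closed_under s U -> {in U, restr_perm U s =1 s}.
Proof. by move=> /closed_norm sU x xU; apply: restr_permE. Qed.

Lemma restr_perm_id U s : {in ~: U, forall x, restr_perm U s x = x}.
Proof. by move=> x; rewrite inE => xU; apply: (out_perm (restr_perm_on U s)). Qed.

(** After restriction to [U], each point outside is a fixed point and a component of its own. It
    adds 3 to the left side of the Euler inequality and 1 + 2 to the right side, so these points
    cancel. *)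
Lemma euler_on U a b rho : transitive_on U a b -> rho \in U ->
  ncycles U a + ncycles U b + ncycles U (b * a) <= #|U| + 2.
Proof.
move=> /and3P[aU bU /forallP tr] rU.
have hR : hits (restr_perm U a) (restr_perm U b) (rho |: ~: U).
  move=> Z aZ bZ Z0; have [sub|/subsetPn[x xZ xU]] := boolP (Z \subset U); last first.
    by apply/set0Pn; exists x; rewrite !inE xZ xU orbT.
  have aux s : closed_under s U -> closed_under (restr_perm U s) Z -> closed_under s Z.
    move=> sU /closed_underP sZ; apply: closed_under_sub => x xZ.
    by rewrite -(restr_permE_closed sU) ?sZ // (subsetP sub).
  move: (tr Z); rewrite (aux a) ?(aux b) ?sub ?Z0 //= => /eqP ->.
  by apply/set0Pn; exists rho; rewrite !inE rU eqxx.
have := euler_inequality hR; rewrite cardsU1 !inE rU.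
have -> := porbits_restrict aU (restr_permE_closed aU) (@restr_perm_id U a).
have -> := porbits_restrict bU (restr_permE_closed bU) (@restr_perm_id U b).
have -> : #|porbits (restr_perm U b * restr_perm U a)| = ncycles U (b * a) + #|~: U|.
  apply: porbits_restrict; first exact: closed_underM.
    move=> x xU; rewrite !permM !restr_permE_closed //.
    by rewrite (closed_underP _ _ bU).
  by move=> x xU; rewrite permM !restr_perm_id.
rewrite -(cardsC U); clear; lia.
Qed.

Section Swap.
Variables (a b : {perm T}) (k r : T) (X : {set T}).
Local Notation b' := (b ^ tperm k r)%g.
Hypotheses (aX : closed_under a X) (bX : closed_under b' X) (kX : k \notin X) (rX : r \in X).

(** Up to the order of factors, [b * a] is [b' * a] multiplied by two transpositions. The first
    merges the faces of [k] and [r], which lie on different sides of [X]. The second merges once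
    more or splits. A split forces [k] and [r] each to have the same face of [b' * a] on both sides,
    as a bridge would. *)
Lemma faces_swap :
  #|porbits (b * a)| + 2 = #|porbits (b' * a)| \/
  [/\ #|porbits (b * a)| = #|porbits (b' * a)|,
      a k \in porbit (b' * a) k & a r \in porbit (b' * a) r].
Proof.
set t := tperm k r; pose t' := tperm (a k) (a r); pose phi := (b' * a)%g.
have e1 : (b * a)%g = ((t * phi) * t')%g.
  have tV : (t^-1 = t)%g by rewrite /t tpermV.
  have tt : (t * t = 1)%g by rewrite /t tperm2.
  by rewrite /phi /t' -tpermJ -/t !conjgE tV !mulgA tt mul1g mulgK -(mulgA b) tt mulg1.
have pX : closed_under phi X by apply: closed_underM.
have knr : k != r by apply: contraNneq kX => ->.
have n1 : k \notin porbit phi r.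
  by apply: contra kX; apply/subsetP/porbit_subset.
have f1 : #|porbits (t * phi)| + 2 = #|porbits phi| + 1.
  by have := porbits_mul_tperm phi k r; rewrite /= n1 knr.
have akr : a k != a r by rewrite (inj_eq perm_inj).
have f2 : #|porbits (t' * (t * phi))| + (a k \notin porbit (t * phi) (a r)).*2 =
    #|porbits (t * phi)| + 1.
  by have := porbits_mul_tperm (t * phi) (a k) (a r); rewrite /= akr.
rewrite -/phi e1 porbits_tpermr -/t'.
have [bad|nb] := boolP (a k \in porbit (t * phi) (a r)); last first.
  by left; rewrite nb in f2; move: f1 f2; clear; lia.
right; rewrite bad in f2; split; first by move: f1 f2; clear; lia.
  apply/negPn/negP=> nk; have [cZ sZ] : closed_under phi (porbit phi (a k)) /\ porbit phi (a k) \subset ~: X.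
    split; first exact: closed_under_porbit.
    by apply: porbit_subset; rewrite ?closed_underC // inE (closed_underP _ _ aX).
  (* If the face of [a k] avoided [k], it would avoid [r] as well, being outside [X]. Then [t] would
     not alter it, and it could not reach [a r], which is in [X]. *)
  have cZ' : closed_under (t * phi) (porbit phi (a k)).
    apply: closed_under_tperm => //; apply/idP/idP => h; first by rewrite porbit_sym h in nk.
    by move/subsetP/(_ _ h): sZ; rewrite inE rX.
  have := subsetP (porbit_subset cZ' (porbit_id _ _)) (a r).
  rewrite porbit_sym => /(_ bad) /(subsetP sZ).
  by rewrite inE (closed_underP _ _ aX) rX.
apply/negPn/negP=> nk; have [cZ sZ] : closed_under phi (porbit phi (a r)) /\ porbit phi (a r) \subset X.
  split; first exact: closed_under_porbit.
  by apply: porbit_subset; rewrite ?(closed_underP _ _ aX).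
have cZ' : closed_under (t * phi) (porbit phi (a r)).
  apply: closed_under_tperm => //; apply/idP/idP => h; last by rewrite porbit_sym h in nk.
  by move: kX; rewrite (subsetP sZ _ h).
have := subsetP (porbit_subset cZ' (porbit_id _ _)) (a k) bad.
by move/(subsetP sZ); rewrite (closed_underP _ _ aX) (negbTE kX).
Qed.

End Swap.
End Planarity.

Section Surgery.
Variable T : finType.
Implicit Types (a b c s t : {perm T}) (X Y Z W U R : {set T}) (x k r rho : T).

(* A bicubic map without its vertices: [U] is the set of edges, [a] and [b] rotate
   around black and white ends, and the faces are the cycles of [b * a]. *)
Definition planar_bicubic_on U a b rho : bool :=
  [&& transitive_on U a b, cubic_on U a, cubic_on U b, planar_on U a b & rho \in U].

Lemma cubic_neq U a x : cubic_on U a -> x \in U -> a x != x.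
Proof.
move=> /forall_inP h xU; apply/negP=> /eqP ax.
have : porbit a x = [set x].
  apply/setP=> y; rewrite inE; apply/porbitP/eqP=> [[i ->]|->]; last by exists 0; rewrite perm1.
  by elim: i => [|i IH]; rewrite ?perm1 // expgSr permM IH.
by move=> e; have := h x xU; rewrite e cards1.
Qed.

Lemma porbits_split s x y : x != y -> x \in porbit s y ->
  #|porbits (s * tperm x y)| = #|porbits s| + 1.
Proof.
move=> xy h; rewrite porbits_tpermr.
by have := porbits_mul_tperm s x y; rewrite /= h xy addn0.
Qed.

Lemma closed_two X a c Z k r :
  transitive_on (~: X) a c -> transitive_on X a c -> k \notin X -> r \in X ->
  closed_under a Z -> closed_under c Z -> Z != set0 -> (k \in Z) || (r \in Z).
Proof.
move=> /and3P[aN cN /forallP hN] /and3P[aX cX /forallP hX] kX rX aZ cZ Z0.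
have [e|n] := eqVneq (Z :&: X) set0; last first.
  have := hX (Z :&: X); rewrite !closed_underI // subsetIr n /= => /eqP/setP/(_ r).
  by rewrite inE rX andbT => ->; rewrite orbT.
have n : Z :&: ~: X != set0 by apply: contra_neq Z0 => e'; rewrite -(setID Z X) setDE e e' setU0.
have := hN (Z :&: ~: X); rewrite !closed_underI // subsetIr n /= => /eqP/setP/(_ k).
by rewrite !inE kX andbT => ->.
Qed.

(* Cutting [k] and [r] out of the cycles of [a] adds two cycles to [a] and two
   to [c * a] but, as cycle lengths are multiples of 3, creates no component:
   the Euler inequality then loses 4. *)
Lemma bridgeless X a c k r :
  transitive_on (~: X) a c -> transitive_on X a c -> k \notin X -> r \in X ->
  cubic_on [set: T] a -> cubic_on [set: T] c ->
  a k \in porbit (c * a) k -> a r \in porbit (c * a) r ->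
  #|porbits a| + #|porbits c| + #|porbits (c * a)| <= #|T|.
Proof.
move=> hN hX kX rX ca cc pk pr.
have [aX cX] : closed_under a X /\ closed_under c X by case/and3P: hX.
have aXE x : (a x \in X) = (x \in X) by apply/closed_underP.
have ak : k != a k by rewrite eq_sym (cubic_neq ca).
have ar : r != a r by rewrite eq_sym (cubic_neq ca).
have knr : k != r by apply: contraNneq kX => ->.
pose tk := tperm k (a k); pose tr := tperm r (a r).
have split2 s : closed_under s X -> k \in porbit s (a k) -> r \in porbit s (a r) ->
    #|porbits (s * tk * tr)| = #|porbits s| + 2.
  move=> sX hk hr; have tkX : {in X, s =1 (s * tk)%g}.
    move=> x xX; rewrite permM tpermD //; apply: contraTneq xX => e; rewrite -(closed_underP _ _ sX) -e //.
    by rewrite aXE.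
  have sX' : closed_under (s * tk)%g X.
    by apply: closed_under_sub => x xX; rewrite -tkX // (closed_underP _ _ sX).
  rewrite porbits_split //; first by rewrite porbits_split // -addnA.
  by rewrite -(eq_porbit_on sX sX' tkX) ?aXE.
have pa x : x \in porbit a (a x) by rewrite porbit_sym (mem_porbit a 1).
set a2 := (a * tk * tr)%g.
have n1 := split2 _ aX (pa k) (pa r).
have n2 : #|porbits (c * a2)| = #|porbits (c * a)| + 2.
  by rewrite /a2 !mulgA; apply: split2; rewrite 1?porbit_sym //; apply: closed_underM.
have hR : hits a2 c [set k; r].
  move=> Z aZ cZ Z0; apply/negP=> /eqP/setP ZR.
  have kZ : k \notin Z by have := ZR k; rewrite !inE eqxx andbT => ->.
  have rZ : r \notin Z by have := ZR r; rewrite !inE eqxx orbT andbT => ->.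
  (* [Z] is closed under [a2], where [k] and [r] have been cut out. Putting them back where needed
     makes it closed under [a] and adds at most two elements; as [#|Z|] and [#|Z1|] are multiples of
     3, none is added. *)
  pose Z1 := Z :|: [set x in [set k; r] | a x \in Z].
  have aZ1 : closed_under a Z1.
    apply/closed_underP=> x; have e2 := closed_underP _ _ aZ x.
    have akr : a k != r by apply: contraNneq kX => e; rewrite -aXE e.
    have ark : a r != k by apply: contraNneq kX => <-; rewrite aXE.
    have [->|xk] := eqVneq x k.
      rewrite !inE eqxx (negbTE kZ) /= [a k == k]eq_sym (negbTE ak) (negbTE akr) /=.
      by rewrite orbF.
    have [->|xr] := eqVneq x r.
      rewrite !inE eqxx orbT (negbTE rZ) /= [a r == r]eq_sym (negbTE ar) (negbTE ark) /=.
      by rewrite orbF.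
    rewrite !inE (negbTE xk) (negbTE xr) /= orbF -e2 !permM /tk /tr.
    have aak : a k != a r by rewrite (inj_eq perm_inj).
    have axk : a x != a k by rewrite (inj_eq perm_inj).
    have axr : a x != a r by rewrite (inj_eq perm_inj).
    have [->|axk'] := eqVneq (a x) k.
      by rewrite (negbTE kZ) tpermL tpermD // eq_sym.
    rewrite (tpermD (x := k)) 1?[k == _]eq_sym // 1?[a k == _]eq_sym //.
    have [->|axr'] := eqVneq (a x) r; first by rewrite (negbTE rZ) tpermL.
    by rewrite tpermD 1?eq_sym //= orbF.
  have /dvdnP[i hi] := card_closed cc cZ (subsetT _).
  have /dvdnP[j hj] := card_closed ca aZ1 (subsetT _).
  have l2 : #|[set x in [set k; r] | a x \in Z]| <= 2.
    rewrite (leq_trans (subset_leq_card (_ : _ \subset [set k; r]))) ?cards2 ?knr //.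
    by apply/subsetP=> x; rewrite inE => /andP[].
  have d0 : Z :&: [set x in [set k; r] | a x \in Z] = set0.
    apply/setP=> x; rewrite !inE; apply/negP=> /and3P[xZ /orP[/eqP e|/eqP e] _].
      by rewrite e (negbTE kZ) in xZ.
    by rewrite e (negbTE rZ) in xZ.
  have e0 : #|[set x in [set k; r] | a x \in Z]| = 0.
    move: hj; rewrite /Z1 cardsU d0 cards0 subn0 hi; move: l2; clear; lia.
  move/eqP: e0; rewrite cards_eq0 => /eqP e0; move: aZ1; rewrite /Z1 e0 setU0 => aZ'.
  by have := closed_two hN hX kX rX aZ' cZ Z0; rewrite (negbTE kZ) (negbTE rZ).
have := euler_inequality hR; rewrite n1 n2 cards2 knr; clear; lia.
Qed.

Lemma cubic_on_conj b t : cubic_on [set: T] (b ^ t) = cubic_on [set: T] b.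
Proof.
apply/forall_inP/forall_inP => h x _.
  by have := h (t x); rewrite porbit_conj card_imset ?inE; [apply | apply: perm_inj].
by rewrite -(permKV t x) porbit_conj card_imset ?h; [|rewrite inE|apply: perm_inj].
Qed.

End Surgery.

(** * Cutting a map along a 2-edge cut, and the inverse insertion *)

Section SplitMerge.
Variable T : finType.
Implicit Types (a b c s t : {perm T}) (X Y Z W U R : {set T}) (x : T).
Variables (a b : {perm T}) (rho k r : T) (X : {set T}).
Hypotheses (kX : k \notin X) (rX : r \in X).
Local Notation b' := (b ^ tperm k r)%g.

(** The Euler counts of the two parts add up to [#|T| + 4]. Gluing either loses two faces, which
    gives the count of the sphere, or loses none, which would exceed the Euler bound for a connected
    map. *)
Lemma planar_glue :
  transitive_on [set: T] a b -> transitive_on (~: X) a b' -> transitive_on X a b' ->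
  planar_on (~: X) a b' -> planar_on X a b' -> planar_on [set: T] a b.
Proof.
move=> hT /and3P[aN bN _] /and3P[aX bX _] /eqP p1 /eqP p2.
have := euler_on hT (in_setT k).
rewrite /planar_on !ncycles_setT cardsT => le.
have := faces_swap aX bX kX rX.
rewrite -(porbits_conj b (tperm k r)) in le *.
have pX := closed_underM bX aX.
rewrite -(ncyclesC aX) -(ncyclesC bX) -(ncyclesC pX) in le *.
rewrite -(cardsC X) in le *.
move=> h; apply/eqP; case: h => [|[]]; move: p1 p2 le; clear; lia.
Qed.

(** Cutting gains two faces, since [bridgeless] excludes the other alternative of [faces_swap]. The
    total is then [#|T| + 4], which is the sum of the Euler bounds of the parts, so both bounds are
    attained. *)
Lemma planar_cut :
  transitive_on (~: X) a b' -> transitive_on X a b' -> rho \notin X ->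
  cubic_on [set: T] a -> cubic_on [set: T] b ->
  planar_on [set: T] a b -> planar_on (~: X) a b' && planar_on X a b'.
Proof.
move=> hN hX rhoX ca cb; have rN : rho \in ~: X by rewrite inE.
have le1 := euler_on hN rN; have le2 := euler_on hX rX.
case/and3P: (hX) => aX bX _; have pX := closed_underM bX aX.
rewrite /planar_on !ncycles_setT cardsT -(porbits_conj b (tperm k r)) => /eqP e.
have cX : #|X| + #|~: X| = #|T| by apply: cardsC.
case: (faces_swap aX bX kX rX) => [h|[h pk pr]]; last first.
  have cb' : cubic_on [set: T] b' by rewrite cubic_on_conj.
  by have := bridgeless hN hX kX rX ca cb' pk pr; rewrite -h; move: e; clear; lia.
move: e h; rewrite -(ncyclesC aX) -(ncyclesC bX) -(ncyclesC pX) -cX => e h.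
apply/andP; split; apply/eqP; move: le1 le2 e h; clear; lia.
Qed.

(* Exchanging the white ends of the two edges [k] and [r] of a cut, that is
   conjugating [b] by [tperm k r], disconnects the map into its two sides. *)
Lemma split_away Y : planar_bicubic_on [set: T] a b rho -> max_away [set: T] a b rho X Y ->
  Y :\: X = [set k] -> X :\: Y = [set r] ->
  [/\ planar_bicubic_on (~: X) a b' rho /\ planar_bicubic_on X a b' r,
      core [set: T] a b rho = core (~: X) a b' rho,
      slots [set: T] a b rho = k |: slots (~: X) a b' rho,
      k \in core (~: X) a b' rho & k \notin slots (~: X) a b' rho].
Proof.
case/and5P=> hT ca cb pl _ [hXY mx] ek er.
have kY : k \in Y by have := set11 k; rewrite -ek inE => /andP[].
have rY : r \notin Y by have := set11 r; rewrite -er inE => /andP[].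
have XE x : (x \in X) = (x != k) && ((x \in Y) || (x == r)).
  move/setP/(_ x): (ek); move/setP/(_ x): (er); rewrite !inE.
  have [->|_] := eqVneq x k; first by rewrite (negbTE kX).
  by case: (x \in X); case: (x \in Y); case: (x == r).
case/and5P: (hXY) => _ _ aX bY /and3P[rhoX _ _].
(* [X] and [Y] differ only in that [r] replaces [k], so the transposition exchanges them and
   conjugation turns closure of [Y] under [b] into closure of [X] under [b']. *)
have bX : closed_under b' X.
  apply/closed_underP=> x; rewrite -(tpermK k r x) permJ.
  have e y : (tperm k r y \in X) = (y \in Y).
    rewrite XE; case: tpermP => [->|->|/eqP yk /eqP yr].
    - by rewrite eqxx orbT eq_sym kY andbT; apply: contraNneq kX => ->.
    - by rewrite eqxx (negbTE rY).
    - by rewrite yk (negbTE yr) orbF.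
  by rewrite !e (closed_underP _ _ bY).
have X0 : X != set0 by apply/set0Pn; exists r.
have XT : X != setT by apply: contraNneq kX => ->; rewrite inE.
have tr Z : closed_under a Z -> closed_under b Z -> Z != set0 -> Z = setT.
  by move=> aZ bZ Z0; case/and3P: hT => _ _ /forallP/(_ Z); rewrite aZ bZ Z0 subsetT => /eqP.
(* Of a closed part of [~: X] and its complement there, one misses [k]. Missing [r] too, it is
   closed under [b] itself, so connectedness of the whole map makes it empty. *)
have hN : transitive_on (~: X) a b'.
  rewrite /transitive_on !closed_underC //=; apply/forallP=> Z; apply/implyP=> /and4P[aZ bZ sZ Z0].
  have rZ : r \notin Z by apply: contraL rX => /(subsetP sZ); rewrite inE.
  have kZ : k \in Z.
    apply: contraT => kZ; have := tr Z aZ; rewrite -(closed_under_tpermP b kZ rZ) => /(_ bZ Z0) e.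
    by rewrite e inE in rZ.
  have [e|n] := eqVneq (~: X :\: Z) set0; first by rewrite eqEsubset sZ -setD_eq0 e eqxx.
  have k1 : k \notin ~: X :\: Z by rewrite !inE kZ.
  have r1 : r \notin ~: X :\: Z by rewrite !inE rX andbF.
  have := tr (~: X :\: Z); rewrite -(closed_under_tpermP b k1 r1) !closed_underD ?closed_underC //.
  by move=> /(_ isT isT n) e; rewrite e inE in k1.
have hX : transitive_on X a b'.
  rewrite /transitive_on aX bX /=; apply/forallP=> Z; apply/implyP=> /and4P[aZ bZ sZ Z0].
  have kZ : k \notin Z by apply: contra kX => /(subsetP sZ).
  have rZ : r \in Z.
    apply: contraT => rZ; have := tr Z aZ; rewrite -(closed_under_tpermP b kZ rZ) => /(_ bZ Z0) e.
    by rewrite e inE in kZ.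
  have [e|n] := eqVneq (X :\: Z) set0; first by rewrite eqEsubset sZ -setD_eq0 e eqxx.
  have k1 : k \notin X :\: Z by rewrite !inE (negbTE kX) andbF.
  have r1 : r \notin X :\: Z by rewrite !inE rZ.
  have := tr (X :\: Z); rewrite -(closed_under_tpermP b k1 r1) !closed_underD //.
  by move=> /(_ isT isT n) e; rewrite e inE in k1.
have cb' : cubic_on [set: T] b' by rewrite cubic_on_conj.
have /andP[p1 p2] := planar_cut hN hX rhoX ca cb pl.
have kc : k \in core [set: T] a b rho.
  by apply: (max_away_core (conj hXY mx)); rewrite ek inE.
have c1 Z W : away [set: T] a b rho Z W ->
    (Z \subset X) /\ (W \subset Y) \/ away (~: X) a b' rho Z W.
  move=> h; case: (mx _ _ h) => [|d]; [by left | right].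
  have dE x : x \in Z :|: W -> x \notin X :|: Y by move=> xZ; rewrite (disjointFl d).
  case/and5P: h => _ _ aZ bW rest.
  have kW : k \notin W by apply/negP=> h; have := dE k; rewrite !inE h kY !orbT => /(_ isT).
  have rW : r \notin W by apply/negP=> h; have := dE r; rewrite !inE h rX !orbT => /(_ isT).
  rewrite /away aZ closed_under_tpermP // bW rest !andbT.
  by apply/andP; split; apply/subsetP=> x h; have := dE x; rewrite !inE h ?orbT negb_or => /(_ isT)/andP[].
have c2 Z W : away (~: X) a b' rho Z W -> away [set: T] a b rho Z W /\ k \notin W.
  move=> h; case/and5P: (h) => sZ sW aZ bW rest.
  have rW : r \notin W by apply: contraL rX => /(subsetP sW); rewrite inE.
  have rZ : r \notin Z by apply: contraL rX => /(subsetP sZ); rewrite inE.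
  have [kW|kW] := boolP (k \in W); last first.
    by split=> //; rewrite /away !subsetT aZ rest andbT -(closed_under_tpermP b kW rW).
  (* With the white end of [k] in [W], the part [X] can be absorbed: the exchange moves the white
     end of [k] from the root part into [X]. The enlarged pair overlaps the maximal one without
     being contained in it. *)
  exfalso; have h2 : away [set: T] a b rho (X :|: Z) (X :|: W).
    rewrite /away !subsetT closed_underU //=.
    have -> : (X :|: Z) :\: (X :|: W) = Z :\: W.
      apply/setP=> x; rewrite !inE; have := subsetP sZ x; rewrite inE.
      by case: (x \in Z); case: (x \in X); case: (x \in W) => // /(_ isT).
    have -> : (X :|: W) :\: (X :|: Z) = W :\: Z.
      apply/setP=> x; rewrite !inE; have := subsetP sW x; rewrite inE.
      by case: (x \in Z); case: (x \in X); case: (x \in W) => // /(_ isT).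
    case/andP: rest => rhoZ ->; rewrite inE negb_or rhoX rhoZ !andbT.
    have -> : b = (b' ^ tperm k r)%g by rewrite -conjgM tperm2 conjg1.
    rewrite -(setCK (X :|: W)); apply: closed_underC.
    rewrite closed_under_tpermP; first by apply: closed_underC; apply: closed_underU.
      by rewrite !inE kW orbT.
    by rewrite !inE rX.
  case: (mx _ _ h2) => [[s _]|].
    case: (away_neq0 h) => /set0Pn[z zZ] _; have := subsetP sZ _ zZ.
    by rewrite inE (subsetP s) // inE zZ orbT.
  by rewrite -setI_eq0 => /eqP/setP/(_ r); rewrite !inE rX.
have core_eq : core [set: T] a b rho = core (~: X) a b' rho.
  apply/setP=> x; rewrite !inE /=; apply/idP/andP=> [h|[xX h]].
    split; first by move/forallP/(_ X)/forallP/(_ Y): h; rewrite hXY.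
    apply/forallP=> Z; apply/forallP=> W; apply/implyP=> /c2[h2 _].
    by move/forallP/(_ Z)/forallP/(_ W): h; rewrite h2.
  apply/forallP=> Z; apply/forallP=> W; apply/implyP=> /c1[[sZ _]|h2].
    by apply: contra xX; apply/subsetP.
  by move/forallP/(_ Z)/forallP/(_ W): h; rewrite h2.
have ks : k \notin slots (~: X) a b' rho.
  rewrite inE; apply/negP=> /andP[_ /existsP[Z /existsP[W /andP[/c2[_ kW]]]]].
  by rewrite (negbTE kW).
split=> //; last by rewrite -core_eq.
  by rewrite /planar_bicubic_on hN hX p1 p2 rX inE rhoX; do !rewrite (cubic_onS (subsetT _)) //.
apply/setP=> x; rewrite in_setU1; apply/idP/orP.
  rewrite inE core_eq => /andP[xc /existsP[Z /existsP[W /andP[h xW]]]].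
  case: (c1 _ _ h) => [[_ /subsetP sW]|h2].
    left; have : x \in Y :\: X by rewrite inE (sW _ xW) andbT; move: xc; rewrite !inE => /andP[].
    by rewrite ek inE.
  by right; rewrite inE xc; apply/existsP; exists Z; apply/existsP; exists W; rewrite h2.
case=> [/eqP->|].
  by rewrite inE kc; apply/existsP; exists X; apply/existsP; exists Y; rewrite hXY.
rewrite inE -core_eq => /andP[xc /existsP[Z /existsP[W /andP[/c2[h _] xW]]]].
by rewrite inE xc; apply/existsP; exists Z; apply/existsP; exists W; rewrite h.
Qed.

(** The two conditions on [k] give the maximality of the new cut. A larger cut would leave a trace
    in the root part, having on its side either the white end of [k], so that [k] is a slot, or the
    black end of [k], so that [k] is not in the core. *)
Lemma merge_vacant : planar_bicubic_on (~: X) a b' rho -> planar_bicubic_on X a b' r ->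
  k \in core (~: X) a b' rho -> k \notin slots (~: X) a b' rho ->
  planar_bicubic_on [set: T] a b rho /\ max_away [set: T] a b rho X (k |: (X :\ r)).
Proof.
case/and5P=> hN caN cbN pN rhoN; case/and5P=> hX caX cbX pX _ kc ks.
have rhoX : rho \notin X by rewrite inE in rhoN.
have cub s : cubic_on (~: X) s -> cubic_on X s -> cubic_on [set: T] s.
  move=> /forall_inP h1 /forall_inP h2; apply/forall_inP=> x _.
  by case: (boolP (x \in X)) => h; [apply: h2 | apply: h1; rewrite inE].
have ca := cub _ caN caX; have cb' := cub _ cbN cbX.
have cb : cubic_on [set: T] b by rewrite -(cubic_on_conj _ (tperm k r)).
case/and3P: (hX) => aX bX _.
have bE : b = (b' ^ tperm k r)%g by rewrite -conjgM tperm2 conjg1.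
have knr : k != r by apply: contraNneq kX => ->.
have swap Z : r \notin Z -> k \in Z -> closed_under b Z -> closed_under b' (r |: (Z :\ k)).
  move=> rZ kZ /closed_underP bZ; apply/closed_underP=> x; rewrite -(tpermK k r x) permJ.
  have e y : (tperm k r y \in r |: (Z :\ k)) = (y \in Z).
    rewrite !inE; case: tpermP => [->|->|/eqP yk /eqP yr]; rewrite ?eqxx ?kZ //.
    - by rewrite (negbTE knr) (negbTE rZ).
    - by rewrite (negbTE yr) yk.
  by rewrite !e.
have hT : transitive_on [set: T] a b.
  rewrite /transitive_on !closed_underT /=; apply/forallP=> Z; apply/implyP=> /and4P[aZ bZ _ Z0].
  (* If [V] contains [k], its trace on [X] is closed under [a], and the trace with [r] added is
     closed under [b']; their sizes differ by 1 although both are multiples of 3. *)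
  have key V : closed_under a V -> closed_under b V -> r \notin V -> V != set0 -> False.
    move=> aV bV rV V0; have [kV|kV] := boolP (k \in V); last first.
      have bV' : closed_under b' V by rewrite closed_under_tpermP.
      by have := closed_two hN hX kX rX aV bV' V0; rewrite (negbTE kV) (negbTE rV).
    have bV' := closed_underI (swap _ rV kV bV) bX.
    have := card_closed ca (closed_underI aV aX) (subsetT _).
    have := card_closed cb' bV' (subsetT _).
    have -> : (r |: (V :\ k)) :&: X = r |: (V :&: X).
      apply/setP=> x; rewrite !inE; have [->|_] /= := eqVneq x r; first by rewrite rX.
      by have [->|_] := eqVneq x k; rewrite ?(negbTE kX) ?andbF.
    have -> : #|r |: (V :&: X)| = #|V :&: X|.+1 by rewrite cardsU1 inE (negbTE rV).
    by move=> /dvdnP[i hi] /dvdnP[j hj]; move: hi hj; clear; lia.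
  have [rZ|rZ] := boolP (r \in Z); last by case: (key Z).
  apply/eqP; rewrite -[Z]setCK; apply/eqP; rewrite -subTset -setC0 setCS subset0.
  by apply/negP=> /negP; apply: key; rewrite ?closed_underC // inE negbK.
have pl := planar_glue hT hN hX pN pX.
have hg : planar_bicubic_on [set: T] a b rho by rewrite /planar_bicubic_on hT ca cb pl inE.
split=> //; set Y := k |: (X :\ r).
have YE x : (x \in Y) = (x == k) || (x != r) && (x \in X) by rewrite !inE.
have eYX : Y :\: X = [set k].
  apply/setP=> x; rewrite !inE; have [->|] //= := eqVneq x k; first by rewrite kX.
  by case: (x \in X) => //; rewrite andbF.
have eXY : X :\: Y = [set r].
  apply/setP=> x; rewrite in_setD YE in_set1; have [->|] //= := eqVneq x r; first by rewrite rX eq_sym (negbTE knr).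
  by case: (x \in X); rewrite ?orbT ?orbF ?andbF.
have bY : closed_under b Y.
  apply/closed_underP=> x; rewrite {1}bE -{1}(tpermK k r x) permJ.
  have e y : (tperm k r y \in Y) = (y \in X).
    rewrite YE; case: tpermP => [->|->|/eqP yk /eqP yr].
    - by rewrite eqxx eq_sym (negbTE knr) (negbTE kX).
    - by rewrite eqxx rX.
    - by rewrite (negbTE yk) yr.
  by rewrite e (closed_underP _ _ bX) -e tpermK.
have hXY : away [set: T] a b rho X Y.
  by rewrite /away !subsetT aX bY rhoX eYX eXY !cards1.
split=> // Z0 W0 h0; have [d|d] := boolP [disjoint X :|: Y & Z0 :|: W0]; [by right | left].
(* An overlapping cut is replaced by its union with [(X, Y)], so it is enough to show that no cut
   properly contains this pair. *)
have h := away_setU hT ca cb (in_setT rho) hXY h0 d.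
set Z := X :|: Z0 in h; set W := Y :|: W0 in h.
suff ZX : Z = X.
  rewrite ZX in h; split; first by apply/setUidPl.
  by apply: subset_trans (subsetUr _ _) (away_uniq hT ca cb (in_setT rho) hXY h).
have XZ : X \subset Z by apply: subsetUl.
have YW : Y \subset W by apply: subsetUl.
clearbody Z W.
apply/eqP; apply: contraT => nZX.
have kW : k \in W by rewrite (subsetP YW) // YE eqxx.
have ZX0 : Z :\: X != set0 by rewrite setD_eq0; apply: contra nZX => s; rewrite eqEsubset s.
case/and5P: h => _ _ aZ bW /and3P[rhoZ /eqP n1 /eqP n2].
(* With [r] in [W], all of [X] is in [W], and removing [X] from both sets leaves a cut of the root
   part with [k] in its second set: [k] would be a slot. *)
have [rW|rW] := boolP (r \in W).
  have XW : X \subset W.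
    apply/subsetP=> x xX; have [->|xr] := eqVneq x r => //.
    by rewrite (subsetP YW) // YE xr xX orbT.
  have h : away (~: X) a b' rho (Z :\: X) (W :\: X).
    rewrite /away !subsetDr closed_underD //= inE rhoX (negbTE rhoZ) /=.
    have -> : Z :\: X :\: (W :\: X) = Z :\: W.
      apply/setP=> x; rewrite !in_setD; have := subsetP XW x.
      by case: (x \in X); case: (x \in W) => // /(_ isT).
    have -> : W :\: X :\: (Z :\: X) = W :\: Z.
      apply/setP=> x; rewrite !in_setD; have := subsetP XZ x.
      by case: (x \in X); case: (x \in Z) => // /(_ isT).
    rewrite n1 n2 eqxx !andbT; apply: closed_underD => //.
    rewrite -(setCK W); apply: closed_underC.
    by rewrite closed_under_tpermP ?closed_underC // inE negbK.
  case/negP: ks; rewrite inE kc; apply/existsP; exists (Z :\: X); apply/existsP; exists (W :\: X).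
  by rewrite h inE kW kX.

(* Now [r] is the only edge of [Z :\: W]. Exchanging [k] and [r] in [W] and removing [X] gives a cut
   of the root part with the black end of [k] on its side, against [k] being a core edge. *)
pose W' := (r |: (W :\ k)) :\: X.
have l1 : Z :\: X :\: W' \subset [set k].
  apply/subsetP=> x; rewrite !inE => /andP[h1 /andP[xX xZ]].
  apply: contraNT h1 => xk; rewrite xX xk /=.
  have [//|xr /=] := eqVneq x r.
  apply: contraT => xW; have : x \in Z :\: W by rewrite inE xW xZ.
  have : r \in Z :\: W by rewrite inE rW (subsetP XZ).
  move/eqP/cards1P: n1 => [z ->]; rewrite !inE => /eqP <- /eqP e.
  by rewrite e eqxx in xr.
have l2 : W' :\: (Z :\: X) \subset W :\: Z.
  apply/subsetP=> x; rewrite !inE => /andP[h1 /andP[xX /orP[/eqP e|/andP[xk ->]]]].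
    by rewrite e rX in xX.
  by move: h1; rewrite xX /= => ->.
have h : away (~: X) a b' rho (Z :\: X) W'.
  have /= l1' := subset_leq_card l1; have /= l2' := subset_leq_card l2.
  rewrite cards1 in l1'; rewrite n2 in l2'.
  apply: small_boundary => //.
  - exact: subsetDr.
  - exact: subsetDr.
  - exact: closed_underD.
  - by apply: closed_underD => //; apply: swap.
  - by rewrite inE (negbTE rhoZ) andbF.
  - by rewrite ZX0.
  - by apply: leq_trans l1' _.
  - by apply: leq_trans l2' _.
  - by apply: leq_trans (leq_add l1' l2') _.
have := core_away kc h.
case/and5P: h => _ _ _ _ /and3P[_ /cards1P[z ez] _].
have := set11 z; rewrite -ez => zin; have := subsetP l1 _ zin.
rewrite inE => /eqP e; move: zin; rewrite e inE => /andP[_ ->].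
by [].
Qed.

End SplitMerge.

(** * Counting labelled maps *)

Section Transport.
Variables (T T' : finType) (h : T' -> T) (U' : {set T'}).
Variables (a b : {perm T}) (a' b' : {perm T'}).
Hypotheses (hI : injective h) (aU : closed_under a' U') (bU : closed_under b' U').
Hypotheses (ha : {in U', forall x, h (a' x) = a (h x)}) (hb : {in U', forall x, h (b' x) = b (h x)}).
Local Notation U := (h @: U').

Lemma closed_transport (s : {perm T}) (s' : {perm T'}) (X : {set T'}) :
  closed_under s' U' -> {in U', forall x, h (s' x) = s (h x)} -> X \subset U' ->
  closed_under s (h @: X) = closed_under s' X.
Proof.
move=> sU hs /subsetP sX; apply/idP/idP => c; apply: closed_under_sub.
  move=> x xX; rewrite -(mem_imset _ _ hI) hs ?sX // (closed_underP _ _ c).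
  exact: imset_f.
move=> _ /imsetP[x xX ->]; rewrite -hs ?sX // imset_f // (closed_underP _ _ c) //.
Qed.

Lemma subset_transport (X : {set T}) : X \subset U ->
  exists2 X' : {set T'}, X' \subset U' & X = h @: X'.
Proof.
move=> /subsetP sX; exists (U' :&: h @^-1: X); first exact: subsetIl.
apply/setP=> y; apply/idP/imsetP=> [yX|[x]].
  by have /imsetP[x xU e] := sX y yX; exists x; rewrite // !inE xU -e.
by rewrite !inE => /andP[_ ?] ->.
Qed.

Lemma transitive_transport : transitive_on U a b = transitive_on U' a' b'.
Proof.
rewrite /transitive_on !(closed_transport _ ha, closed_transport _ hb) // aU bU /=.
apply/forallP/forallP => tr Z; apply/implyP=> /and4P[aZ bZ sZ Z0].
  have := tr (h @: Z); rewrite (closed_transport _ ha) // (closed_transport _ hb) // aZ bZ imsetS //=.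
  rewrite (_ : h @: Z != set0) /=; last by rewrite imset_eq0.
  by move=> /eqP/imset_inj e; apply/eqP/e.
have [Z' sZ' eZ] := subset_transport sZ; have := tr Z'.
rewrite -(closed_transport _ ha) // -(closed_transport _ hb) // -eZ aZ bZ sZ' /=.
by rewrite eZ imset_eq0 in Z0 *; rewrite Z0 => /eqP ->.
Qed.

Lemma porbit_transport (s : {perm T}) (s' : {perm T'}) :
  closed_under s' U' -> {in U', forall x, h (s' x) = s (h x)} ->
  {in U', forall x, porbit s (h x) = h @: porbit s' x}.
Proof.
move=> sU hs x xU; have e i : (s ^+ i)%g (h x) = h ((s' ^+ i)%g x) /\ (s' ^+ i)%g x \in U'.
  elim: i => [|i [IH1 IH2]]; first by rewrite !perm1.
  by rewrite !expgSr !permM IH1 hs // (closed_underP _ _ sU).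
apply/setP=> y; apply/porbitP/imsetP=> [[i ->]|[z /porbitP[i ->] ->]].
  by exists ((s' ^+ i)%g x); rewrite ?mem_porbit //; case: (e i).
by exists i; case: (e i).
Qed.

Lemma cubic_transport (s : {perm T}) (s' : {perm T'}) :
  closed_under s' U' -> {in U', forall x, h (s' x) = s (h x)} ->
  cubic_on U s = cubic_on U' s'.
Proof.
move=> sU hs; apply/forall_inP/forall_inP => c x.
  by move=> xU; have := c (h x); rewrite (porbit_transport sU hs) // card_imset //; apply; apply: imset_f.
by case/imsetP=> z zU ->; rewrite (porbit_transport sU hs) // card_imset //; apply: c.
Qed.

Lemma ncycles_transport (s : {perm T}) (s' : {perm T'}) :
  closed_under s' U' -> {in U', forall x, h (s' x) = s (h x)} ->
  ncycles U s = ncycles U' s'.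
Proof.
move=> sU hs; rewrite /ncycles -imset_comp.
have -> : (porbit s \o h) @: U' = (fun A : {set T'} => h @: A) @: (porbit s' @: U').
  by rewrite -imset_comp; apply: eq_in_imset => x xU; rewrite /= (porbit_transport sU hs).
by rewrite card_imset //; apply: imset_inj.
Qed.

Lemma bicubic_on_transport rho : planar_bicubic_on U a b (h rho) = planar_bicubic_on U' a' b' rho.
Proof.
rewrite /planar_bicubic_on transitive_transport (cubic_transport aU ha) (cubic_transport bU hb).
rewrite mem_imset // /planar_on (ncycles_transport aU ha) (ncycles_transport bU hb).
rewrite (@ncycles_transport _ (b' * a')%g) ?card_imset //; first exact: closed_underM.
by move=> x xU; rewrite !permM ha ?hb // (closed_underP _ _ bU).
Qed.

Lemma away_transport rho (X Y : {set T'}) : X \subset U' -> Y \subset U' ->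
  away U a b (h rho) (h @: X) (h @: Y) = away U' a' b' rho X Y.
Proof.
move=> sX sY; rewrite /away !imsetS // sX sY.
rewrite (closed_transport aU ha) // (closed_transport bU hb) // mem_imset //.
have D (A B : {set T'}) : (h @: A) :\: (h @: B) = h @: (A :\: B).
  apply/setP=> y; apply/setDP/imsetP=> [[/imsetP[x xA ->]]|[x]].
    by rewrite mem_imset // => xB; exists x; rewrite // inE xA xB.
  by rewrite inE => /andP[xB xA] ->; rewrite !mem_imset.
by rewrite !D !card_imset.
Qed.

Lemma core_transport rho : core U a b (h rho) = h @: core U' a' b' rho.
Proof.
apply/setP=> y; apply/idP/imsetP=> [|[x]].
  rewrite inE => /andP[/imsetP[x xU ->] c]; exists x => //; rewrite inE xU /=.
  apply/forallP=> X; apply/forallP=> Y; apply/implyP=> hXY.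
  have [sX sY] : X \subset U' /\ Y \subset U' by case/and3P: hXY.
  move/forallP/(_ (h @: X))/forallP/(_ (h @: Y)): c.
  by rewrite away_transport // hXY mem_imset.
rewrite inE => /andP[xU c ->]; rewrite inE imset_f //=.
apply/forallP=> X; apply/forallP=> Y; apply/implyP=> hXY.
have [sX sY] : X \subset U /\ Y \subset U by case/and3P: hXY.
have [X' sX' eX] := subset_transport sX; have [Y' sY' eY] := subset_transport sY.
move: hXY; rewrite eX eY away_transport // => hXY.
by move/forallP/(_ X')/forallP/(_ Y'): c; rewrite hXY mem_imset.
Qed.

Lemma slots_transport rho : slots U a b (h rho) = h @: slots U' a' b' rho.
Proof.
apply/setP=> y; apply/idP/imsetP=> [|[x]].
  rewrite inE core_transport => /andP[/imsetP[x xc ->]].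
  move=> /existsP[X /existsP[Y /andP[hXY xY]]]; exists x => //; rewrite inE xc.
  have [sX sY] : X \subset U /\ Y \subset U by case/and3P: hXY.
  have [X' sX' eX] := subset_transport sX; have [Y' sY' eY] := subset_transport sY.
  apply/existsP; exists X'; apply/existsP; exists Y'.
  by move: hXY xY; rewrite eX eY away_transport // => ->; rewrite mem_imset.
rewrite inE => /andP[xc /existsP[X /existsP[Y /andP[hXY xY]]]] ->.
rewrite inE core_transport imset_f //=; apply/existsP; exists (h @: X); apply/existsP; exists (h @: Y).
have [sX sY] : X \subset U' /\ Y \subset U' by case/and3P: hXY.
by rewrite away_transport // hXY imset_f.
Qed.

End Transport.

Section Labelled.
Variable T : finType.
Implicit Types (U X : {set T}) (m : {perm T} * {perm T} * T).

(** The permutations are trivial outside [U], so that each map with edge set [U] occurs once. *)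
Definition labelled U : {set {perm T} * {perm T} * T} :=
  [set m | [&& perm_on U m.1.1, perm_on U m.1.2 & planar_bicubic_on U m.1.1 m.1.2 m.2]].

Definition labelled_core U (j i : nat) : {set {perm T} * {perm T} * T} :=
  [set m in labelled U | (#|core U m.1.1 m.1.2 m.2| == 3 * j) &&
                         (#|slots U m.1.1 m.1.2 m.2| == i)].

Lemma perm_on_closed U (s : {perm T}) : perm_on U s -> closed_under s U.
Proof. by move=> h; apply/closed_underP=> x; apply: perm_closed. Qed.

End Labelled.

Section Extend.
Variables (T T' : finType) (h : T' -> T).
Hypothesis hI : injective h.

Definition extend_fun (p : {perm T'}) (y : T) : T :=
  if [pick x | h x == y] is Some x then h (p x) else y.

Lemma extend_funE p x : extend_fun p (h x) = h (p x).
Proof.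
rewrite /extend_fun; case: pickP => [z /eqP/hI -> //|/(_ x)].
by rewrite eqxx.
Qed.

Lemma extend_fun_id p y : y \notin h @: setT -> extend_fun p y = y.
Proof.
move=> ny; rewrite /extend_fun; case: pickP => // x /eqP e.
by rewrite -e imset_f in ny.
Qed.

Lemma extend_inj p : injective (extend_fun p).
Proof.
have im z : (extend_fun p z \in h @: setT) = (z \in h @: setT).
  have [/imsetP[x _ ->]|n] := boolP (z \in h @: setT).
    by rewrite extend_funE !imset_f.
  by rewrite extend_fun_id // (negbTE n).
move=> y z e; have := im y; rewrite e im.
have [/imsetP[x _ ey]|ny] := boolP (y \in h @: setT).
  by move=> /imsetP[w _ ew]; move: e; rewrite ey ew !extend_funE => /hI/perm_inj ->.
by move=> nz; move: e; rewrite !extend_fun_id // nz.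
Qed.

End Extend.

Section ExtendPerm.
Variables (T T' : finType) (h : T' -> T).
Hypothesis hI : injective h.

Definition extend (p : {perm T'}) : {perm T} := perm (extend_inj hI (p := p)).

Lemma extendE p x : extend p (h x) = h (p x).
Proof. by rewrite permE extend_funE. Qed.

Lemma extend_on p : perm_on (h @: setT) (extend p).
Proof.
apply/subsetP=> y; rewrite inE; apply: contraR => ny.
by rewrite permE extend_fun_id.
Qed.

Lemma extendI : injective extend.
Proof. by move=> p q e; apply/permP=> x; apply: hI; rewrite -!extendE e. Qed.

Lemma extend_surj (a : {perm T}) : perm_on (h @: setT) a -> exists p, a = extend p.
Proof.
move=> ha; pose f x := odflt x [pick x' | h x' == a (h x)].
have fE x : h (f x) = a (h x).
  rewrite /f; case: pickP => [x' /eqP //|n].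
  have : a (h x) \in h @: setT by rewrite (perm_closed _ ha) imset_f.
  by case/imsetP=> z _ e; have := n z; rewrite e eqxx.
have fI : injective f by move=> x y e; apply: hI; apply: (@perm_inj _ a); rewrite -!fE e.
exists (perm fI); apply/permP=> y; have [/imsetP[x _ ->]|ny] := boolP (y \in h @: setT).
  by rewrite extendE permE fE.
by rewrite (out_perm ha) // (out_perm (extend_on _)).
Qed.

Let f (m : {perm T'} * {perm T'} * T') : {perm T} * {perm T} * T :=
  (extend m.1.1, extend m.1.2, h m.2).

Let fI : injective f.
Proof. by move=> [[a b] x] [[c d] y] [] /extendI -> /extendI -> /hI ->. Qed.

Let hE (p : {perm T'}) : {in [set: T'], forall x, h (p x) = extend p (h x)}.
Proof. by move=> x _; rewrite extendE. Qed.

Lemma labelled_transport : labelled (h @: setT) = f @: labelled [set: T'].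
Proof.
apply/setP=> -[[a b] y]; apply/idP/imsetP=> [|[[[p q] x]]]; last first.
  rewrite !inE /= => /and3P[_ _ g] [-> -> ->].
  by rewrite !extend_on (bicubic_on_transport hI (closed_underT p) (closed_underT q) (@hE p) (@hE q)).
rewrite inE /= => /and3P[/extend_surj[p ->] /extend_surj[q ->] g].
have /imsetP[x _ e] : y \in h @: setT by case/and5P: g.
exists (p, q, x); last by rewrite e.
move: g; rewrite e (bicubic_on_transport hI (closed_underT p) (closed_underT q) (@hE p) (@hE q)).
by rewrite inE /= => ->; rewrite !andbT; apply/andP; split; apply/subsetP.
Qed.

Lemma card_labelled_transport : #|labelled (h @: setT)| = #|labelled [set: T']|.
Proof. by rewrite labelled_transport card_imset. Qed.

Lemma card_labelled_core_transport j i :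
  #|labelled_core (h @: setT) j i| = #|labelled_core [set: T'] j i|.
Proof.
rewrite -(card_imset _ fI); apply: eq_card => m.
rewrite inE labelled_transport; apply/andP/imsetP => [[/imsetP[m' h1 ->]]|[m' h1 ->]].
  case: m' h1 => [[p q] x] h1.
  rewrite /= (core_transport hI (closed_underT p) (closed_underT q) (@hE p) (@hE q)).
  rewrite (slots_transport hI (closed_underT p) (closed_underT q) (@hE p) (@hE q)).
  by rewrite !card_imset // => h2; exists (p, q, x); rewrite // inE h1.
move: h1; rewrite inE => /andP[h1 h2]; rewrite imset_f //; split=> //.
case: m' h2 {h1} => [[p q] x].
rewrite /= (core_transport hI (closed_underT p) (closed_underT q) (@hE p) (@hE q)).
rewrite (slots_transport hI (closed_underT p) (closed_underT q) (@hE p) (@hE q)).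
by rewrite !card_imset.
Qed.

End ExtendPerm.

Definition num_labelled (N : nat) : nat := #|labelled [set: 'I_N]|.

Definition num_labelled_core (N j i : nat) : nat := #|labelled_core [set: 'I_N] j i|.

Section Counting.
Variable T : finType.
Implicit Types (U X : {set T}) (m : {perm T} * {perm T} * T).

Lemma enum_val_imset U : (@enum_val T (mem U)) @: setT = U.
Proof.
apply/setP=> x; apply/imsetP/idP=> [[i _ ->]|xU]; first exact: enum_valP.
by exists (enum_rank_in xU x); rewrite ?enum_rankK_in.
Qed.

(** An enumeration of [U] transports maps on ['I_#|U|] to maps on [U]. *)
Lemma card_labelled U : #|labelled U| = num_labelled #|U|.
Proof. by rewrite -{1}(enum_val_imset U) card_labelled_transport //; apply: enum_val_inj. Qed.

Lemma card_labelled_core U j i : #|labelled_core U j i| = num_labelled_core #|U| j i.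
Proof. by rewrite -{1}(enum_val_imset U) card_labelled_core_transport //; apply: enum_val_inj. Qed.

Lemma eq_on_transport (U : {set T}) (a b a' b' : {perm T}) rho :
  closed_under a' U -> closed_under b' U -> {in U, a' =1 a} -> {in U, b' =1 b} ->
  [/\ planar_bicubic_on U a b rho = planar_bicubic_on U a' b' rho, core U a b rho = core U a' b' rho &
      slots U a b rho = slots U a' b' rho].
Proof.
move=> aU bU ha hb; have hi : injective (@id T) by [].
have := bicubic_on_transport (h := id) hi aU bU ha hb rho.
have := core_transport (h := id) hi aU bU ha hb rho.
have := slots_transport (h := id) hi aU bU ha hb rho.
by rewrite !imset_id.
Qed.

Lemma perm_on_decomp U (a1 a2 : {perm T}) : perm_on (~: U) a1 -> perm_on U a2 ->
  {in ~: U, a1 =1 (a1 * a2)%g} /\ {in U, a2 =1 (a1 * a2)%g}.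
Proof.
move=> h1 h2; split=> x xU; rewrite permM.
  by rewrite (out_perm h2) // -in_setC (perm_closed _ h1).
by rewrite (out_perm h1) // inE negbK.
Qed.

Lemma perm_on_mul_inj U (a1 a2 c1 c2 : {perm T}) :
  perm_on (~: U) a1 -> perm_on U a2 -> perm_on (~: U) c1 -> perm_on U c2 ->
  (a1 * a2 = c1 * c2)%g -> a1 = c1 /\ a2 = c2.
Proof.
move=> h1 h2 h3 h4 e; have [e1 e2] := perm_on_decomp h1 h2; have [e3 e4] := perm_on_decomp h3 h4.
split; apply/permP=> x; have [xU|xU] := boolP (x \in U).
- by rewrite (out_perm h1) ?(out_perm h3) // inE negbK.
- by rewrite e1 ?inE // e -e3 ?inE.
- by rewrite e2 // e -e4.
- by rewrite (out_perm h2) ?(out_perm h4).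
Qed.

Lemma restr_perm_mul U (a : {perm T}) : closed_under a U ->
  (restr_perm (~: U) a * restr_perm U a)%g = a.
Proof.
move=> aU; have aC := closed_underC aU.
have [e1 e2] := perm_on_decomp (restr_perm_on (~: U) a) (restr_perm_on U a).
apply/permP=> x; have [xU|xU] := boolP (x \in U).
  by rewrite -e2 // restr_permE_closed.
by rewrite -e1 ?inE // restr_permE_closed // inE.
Qed.

End Counting.

Lemma card_dep_pairs (A B : finType) (D : {set A}) (F : A -> {set B}) :
  #|[set q : A * B | (q.1 \in D) && (q.2 \in F q.1)]| = \sum_(x in D) #|F x|.
Proof.
rewrite -sum1_card [RHS](eq_bigr (fun x => \sum_(y in F x) 1)); last by move=> x _; rewrite sum1_card.
by rewrite pair_big_dep; apply: eq_bigl => q; rewrite inE.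
Qed.

(** * Insertion of a map into a vacant core edge *)

Section Insertion.
Variable T : finType.
Implicit Types (X : {set T}).
Local Notation S := ({perm T} * {perm T} * T)%type.
Implicit Types (m : S).

Let coreS X m := core X m.1.1 m.1.2 m.2.
Let slotsS X m := slots X m.1.1 m.1.2 m.2.

Definition slotted (j i : nat) : {set S * T} :=
  [set q | (q.1 \in labelled_core [set: T] j i) && (q.2 \in slotsS [set: T] q.1)].

Definition vacant (X : {set T}) (j i : nat) : {set S * T} :=
  [set p | (p.1 \in labelled_core X j i) && (p.2 \in coreS X p.1 :\: slotsS X p.1)].

(** The data of an insertion: the label set [X] given to the inserted map, a map on the remaining
    labels with a core edge that is not yet a slot, and the inserted map on [X], whose root is the
    edge to be exchanged with it. *)
Definition insertions (j i : nat) : {set {set T} * ((S * T) * S)} :=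
  [set q | (q.1 \in [set: {set T}]) &&
           (q.2 \in setX (vacant (~: q.1) j i) (labelled q.1))].

Definition insert (q : {set T} * ((S * T) * S)) : S * T :=
  let: (X, ((a1, b1, rho, k), (a2, b2, r))) := q in
  ((a1 * a2)%g, ((b1 * b2) ^ tperm k r)%g, rho, k).

Lemma card_slotted j i : #|slotted j i| = i * num_labelled_core #|T| j i.
Proof.
rewrite (card_dep_pairs _ (slotsS setT)) -cardsT -card_labelled_core (eq_bigr (fun => i)) ?sum_nat_const 1?mulnC //.
by move=> m; rewrite inE => /and3P[_ _ /eqP].
Qed.

Lemma slots_sub X m : slotsS X m \subset coreS X m.
Proof. by apply/subsetP=> x; rewrite inE => /andP[]. Qed.

Lemma card_insertions j i :
  #|insertions j i| = \sum_(X : {set T})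
    (3 * j - i) * num_labelled_core #|~: X| j i * num_labelled #|X|.
Proof.
rewrite (card_dep_pairs _ (fun X => setX (vacant (~: X) j i) (labelled X))).
apply: eq_big => [X|X _]; first by rewrite inE.
rewrite cardsX card_labelled; congr (_ * _).
rewrite (card_dep_pairs _ (fun m => coreS (~: X) m :\: slotsS (~: X) m)).
rewrite -card_labelled_core mulnC -sum_nat_const; apply: eq_bigr => m.
rewrite inE => /and3P[_ /eqP <- /eqP <-].
by rewrite cardsD (setIidPr (slots_sub (~: X) m)).
Qed.

Lemma insertionsP j i X a1 b1 rho k a2 b2 r :
  (X, ((a1, b1, rho, k), (a2, b2, r))) \in insertions j i ->
  [/\ [/\ perm_on (~: X) a1, perm_on (~: X) b1, perm_on X a2 & perm_on X b2], k \notin X, r \in X &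
    [/\ planar_bicubic_on (~: X) (a1 * a2) (b1 * b2) rho, planar_bicubic_on X (a1 * a2) (b1 * b2) r,
        k \in core (~: X) (a1 * a2) (b1 * b2) rho, k \notin slots (~: X) (a1 * a2) (b1 * b2) rho &
        #|core (~: X) (a1 * a2) (b1 * b2) rho| = 3 * j /\
        #|slots (~: X) (a1 * a2) (b1 * b2) rho| = i]].
Proof.
rewrite inE /= in_setT /= => /setXP[h1 h2].
move: h1; rewrite inE /= => /andP[h1 /setDP[kc ks]].
move: h1; rewrite inE /= => /and3P[h1 /eqP cc /eqP cs].
move: h1; rewrite inE /= => /and3P[oa1 ob1 g1].
move: h2; rewrite inE /= => /and3P[oa2 ob2 g2].
have [ea1 ea2] := perm_on_decomp oa1 oa2; have [eb1 eb2] := perm_on_decomp ob1 ob2.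
have [-> -> ->] := eq_on_transport rho (perm_on_closed oa1) (perm_on_closed ob1) ea1 eb1.
have [-> _ _] := eq_on_transport r (perm_on_closed oa2) (perm_on_closed ob2) ea2 eb2.
have rX : r \in X by case/and5P: g2.
split=> //.
by have := kc; rewrite /coreS /core in_set => /andP[+ _]; rewrite in_setC.
Qed.

(** The marked slot [k] recovers everything: it belongs to only one maximal cut, whose first set is
    [X], and [r] is the element of [X] missing from the second set. *)
Lemma insert_inj j i : {in insertions j i &, injective insert}.
Proof.
move=> [X [[[[a1 b1] rho] k] [[a2 b2] r]]] [X' [[[[c1 d1] rho'] k'] [[c2 d2] r']]].
move=> /insertionsP[[oa1 ob1 oa2 ob2] kX rX [g1 g2 kc ks _]].
move=> /insertionsP[[oc1 od1 oc2 od2] kX' rX' [g1' g2' kc' ks' _]].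
rewrite /insert => -[ea eb erho ek]; subst rho' k'.
have hb (s t : {perm T}) : ((s ^ t) ^ t)%g = (s ^ (t * t))%g by rewrite conjgM.
pose b := ((b1 * b2) ^ tperm k r)%g.
have eb1 : (b1 * b2 = b ^ tperm k r)%g by rewrite hb tperm2 conjg1.
have eb2 : (d1 * d2 = b ^ tperm k r')%g by rewrite /b eb hb tperm2 conjg1.
rewrite eb1 in g1 g2 kc ks; rewrite -ea eb2 in g1' g2' kc' ks'.
have [g mx] := merge_vacant kX rX g1 g2 kc ks.
have [_ mx'] := merge_vacant kX' rX' g1' g2' kc' ks'.
case/and5P: g => hT ca cb _ hr.
have [eX eY] := max_away_inj mx mx' (setU11 _ _) (setU11 _ _); subst X'.
have er : r = r'.
  apply/eqP; apply: contraT => n; move/setP/(_ r): eY; rewrite !inE eqxx rX n /=.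
  by have /negbTE -> : r != k by apply: contraNneq kX => <-.
subst r'; have e2 : (b1 * b2 = d1 * d2)%g by rewrite eb1 eb2.
have [-> ->] := perm_on_mul_inj oa1 oa2 oc1 oc2 ea.
by have [-> ->] := perm_on_mul_inj ob1 ob2 od1 od2 e2.
Qed.

(** Insertion leaves the core unchanged and makes [k] a new slot; conversely, cutting along the
    maximal cut of a slot makes that slot vacant. *)
Lemma insert_image j i : insert @: insertions j i = slotted j i.+1.
Proof.
apply/setP=> -[[[a b] rho] k]; apply/imsetP/idP.
  move=> [[X [[[[a1 b1] rho'] k'] [[a2 b2] r]]]] /insertionsP[_ kX rX [g1 g2 kc ks [cc cs]]].
  case=> -> -> -> -> {a b rho k}; rename rho' into rho, k' into k.
  set a := (a1 * a2)%g in g1 g2 kc ks cc cs *; set b0 := (b1 * b2)%g in g1 g2 kc ks cc cs *.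
  pose b := (b0 ^ tperm k r)%g.
  have eb : (b0 = b ^ tperm k r)%g by rewrite -conjgM tperm2 conjg1.
  rewrite eb in g1 g2 kc ks cc cs.
  have [g mx] := merge_vacant kX rX g1 g2 kc ks.
  have rk : (r == k) = false by apply: contraNF kX => /eqP <-.
  have e1 : (k |: X :\ r) :\: X = [set k].
    apply/setP=> x; rewrite !inE; have [->|_] /= := eqVneq x k; first by rewrite kX.
    by case: (x \in X); rewrite ?andbF.
  have e2 : X :\: (k |: X :\ r) = [set r].
    apply/setP=> x; rewrite !inE; have [->|_] /= := eqVneq x r; first by rewrite rX rk.
    by case: (x \in X); rewrite ?orbT ?andbF.
  have [_ eC eS _ _] := split_away kX rX g mx e1 e2.
  rewrite inE /= -/b /slotsS /= eS setU11 andbT inE /= eC eS cc cardsU1 ks cs !eqxx !andbT.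
  by rewrite inE /= g andbT; apply/andP; split; apply/subsetP.
rewrite inE /= => /andP[]; rewrite inE /= => /and3P[].
rewrite inE /= => /and3P[_ _ g] /eqP cc /eqP cs kS.
case/and5P: (g) => hT ca cb _ hr.
have /(slotsP hT ca cb hr)[X [Y [mx kY]]] := kS.
case/and5P: (proj1 mx) => _ _ aX bY /and3P[rhoX /cards1P[r er] /cards1P[k' ek]].
have ek' : k = k' by move: kY; rewrite ek inE => /eqP.
subst k'; have kX : k \notin X by case/setDP: kY.
have rX : r \in X by have := set11 r; rewrite -er => /setDP[].
have [[g1 g2] eC eS kc ks] := split_away kX rX g mx ek er.
pose b' := (b ^ tperm k r)%g; have bX : closed_under b' X by case/and5P: g2 => /and3P[].
exists (X, ((restr_perm (~: X) a, restr_perm (~: X) b', rho, k),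
            (restr_perm X a, restr_perm X b', r))); last first.
  by rewrite /insert !restr_perm_mul // -conjgM tperm2 conjg1.
have aC := closed_underC aX; have bC := closed_underC bX.
have eq1 := restr_permE_closed aC; have eq2 := restr_permE_closed bC.
have eq3 := restr_permE_closed aX; have eq4 := restr_permE_closed bX.
have eqV (U : {set T}) (s t : {perm T}) : {in U, s =1 t} -> {in U, t =1 s}.
  by move=> e x xU; rewrite e.
have [E1 E2 E3] := eq_on_transport rho aC bC (eqV _ _ _ eq1) (eqV _ _ _ eq2).
have [E4 _ _] := eq_on_transport r aX bX (eqV _ _ _ eq3) (eqV _ _ _ eq4).
rewrite inE /= in_setT /=; apply/setXP; split; last by rewrite inE /= !restr_perm_on E4.
rewrite inE /= /coreS /slotsS /= E2 E3 in_setD ks kc andbT inE /= E2 E3 -eC cc.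
rewrite inE /= !restr_perm_on E1 g1 eqxx /=.
by move: cs; rewrite eS cardsU1 ks add1n => -[<-]; rewrite eqxx.
Qed.

(* Both sides count the pairs of a map and one of its slots; on the right [m] is
   the number of edges of the map inserted there. *)
Lemma insertion_count j i :
  i.+1 * num_labelled_core #|T| j i.+1 =
  \sum_(m < #|T|.+1) 'C(#|T|, m) *
    ((3 * j - i) * num_labelled_core (#|T| - m) j i * num_labelled m).
Proof.
rewrite -card_slotted -insert_image card_in_imset; last exact: insert_inj.
rewrite card_insertions (partition_big (fun X : {set T} => inord #|X| : 'I_#|T|.+1) xpredT) //=.
apply: eq_bigr => m _; rewrite -card_draws -sum_nat_const; apply: eq_big => [X|X].
  by rewrite inE -(inj_eq val_inj) /= inordK // ltnS max_card.
move=> /eqP/(congr1 val); rewrite /= inordK ?ltnS ?max_card // => <-.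
by rewrite -(cardsC X) addKn.
Qed.

End Insertion.

Definition labelled3 (T : finType) : {set {perm T} * {perm T} * T} :=
  [set m in labelled [set: T] | slots [set: T] m.1.1 m.1.2 m.2 == set0].

Lemma labelled_bicubic_on (T : finType) (U : {set T}) (m : {perm T} * {perm T} * T) :
  m \in labelled U -> planar_bicubic_on U m.1.1 m.1.2 m.2.
Proof. by rewrite inE => /and3P[]. Qed.

Lemma core_full (T : finType) (m : {perm T} * {perm T} * T) : m \in labelled [set: T] ->
  slots [set: T] m.1.1 m.1.2 m.2 = set0 -> core [set: T] m.1.1 m.1.2 m.2 = setT.
Proof.
move=> /labelled_bicubic_on/and5P[hT ca cb _ hr] /(slots0_away hT ca cb hr) h.
apply/setP=> x; rewrite !inE /=; apply/forallP=> X; apply/forallP=> Y.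
by rewrite (negbTE (h X Y)).
Qed.

(** Without slots there is no 2-edge cut, so the core is the whole map. *)
Lemma num_labelled_core0 N j :
  num_labelled_core N j 0 = if N == 3 * j then #|labelled3 'I_N| else 0.
Proof.
rewrite /num_labelled_core; case: eqP => [e|ne].
  apply: eq_card => m; rewrite inE [in RHS]inE cards_eq0; apply/andP/andP => -[h].
    by move=> /andP[].
  by move=> /eqP s; split=> //; rewrite s eqxx andbT core_full // cardsT card_ord; apply/eqP.
apply: eq_card0 => m; rewrite inE; apply/negbTE/negP=> /and3P[h1 /eqP e].
rewrite cards_eq0 => /eqP s; move: e; rewrite core_full // cardsT card_ord.
exact: ne.
Qed.

Lemma num_labelled_dvd N : ~~ (3 %| N) -> num_labelled N = 0.
Proof.
move=> n3; apply: eq_card0 => m; apply/negbTE/negP=> /labelled_bicubic_on/and5P[_ ca _ _ _].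
by have := card_closed ca (closed_underT _) (subsetT _); rewrite cardsT card_ord (negbTE n3).
Qed.

Lemma num_labelled0 : num_labelled 0 = 0.
Proof. by apply: eq_card0 => -[[a b] []]. Qed.

Lemma num_labelled_sum n : num_labelled (3 * n) =
  \sum_(1 <= j < n.+1) \sum_(i < (3 * j).+1) num_labelled_core (3 * n) j i.
Proof.
rewrite /num_labelled /num_labelled_core; set T := 'I_(3 * n).
pose c (m : {perm T} * {perm T} * T) := #|core [set: T] m.1.1 m.1.2 m.2|.
pose d (m : {perm T} * {perm T} * T) := #|slots [set: T] m.1.1 m.1.2 m.2|.
have hc m : m \in labelled setT -> 3 %| c m /\ 0 < c m <= 3 * n.
  move=> /labelled_bicubic_on/and5P[hT ca cb _ hr]; split; first exact: core_card hT ca.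
  have lc : c m <= 3 * n by apply: leq_trans (max_card _) _; rewrite card_ord.
  rewrite lc andbT card_gt0; apply/set0Pn; exists m.2; exact: root_core.
have hd m : d m <= c m.
  by apply: subset_leq_card; apply/subsetP=> x; rewrite inE => /andP[].
pose P j i (m : {perm T} * {perm T} * T) := (c m == 3 * j) && (d m == i).
have cE j i : #|labelled_core [set: T] j i| = \sum_(m in labelled [set: T]) P j i m.
  rewrite -sum1_card big_mkcond [RHS]big_mkcond; apply: eq_bigr => m _.
  by rewrite [_ \in labelled_core _ _ _]inE /P /c /d; case: (_ \in labelled _) => //=; case: (_ && _).
under eq_bigr => j _ do (under eq_bigr => i _ do rewrite cE; rewrite exchange_big).
rewrite exchange_big -sum1_card; apply: eq_bigr => m /hc[/dvdnP[q e] l].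
have hq : 1 <= q < n.+1 by move: e l; clear; lia.
rewrite (bigD1_seq q) ?mem_index_iota ?iota_uniq //= [X in _ + X]big1 ?addn0; last first.
  by move=> j nj; rewrite big1 // => i _; rewrite /P e mulnC eqn_mul2l /= eq_sym (negbTE nj).
have ld : d m < (3 * q).+1 by rewrite ltnS mulnC -e hd.
rewrite (bigD1 (Ordinal ld)) //= /P e mulnC !eqxx big1 ?addn0 // => i ni.
by rewrite andTb; case: eqP => // di; case/eqP: ni; apply: val_inj.
Qed.

Lemma sum_ord_mul3 (F : nat -> nat) n : (forall s, ~~ (3 %| s) -> F s = 0) ->
  \sum_(s < (3 * n).+1) F s = \sum_(m < n.+1) F (3 * m).
Proof.
move=> h; elim: n => [|n IH]; first by rewrite !big_ord1.
have h1 : F (3 * n).+1 = 0 by apply: h; lia.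
have h2 : F (3 * n).+2 = 0 by apply: h; lia.
by rewrite [in RHS]big_ord_recr /= -IH mulnS !big_ord_recr /= h1 h2 !addn0 add3n.
Qed.

(** * Solution of the insertion recurrence *)

Section Solve.
Variables (N : nat) (beta gam : nat -> nat).
Hypothesis beta0 : beta 0 = 0.
Hypothesis labE : forall n, 0 < n <= N -> num_labelled (3 * n) = (3 * n)`! * beta n.
Hypothesis lab3E : forall n, 0 < n <= N -> #|labelled3 'I_(3 * n)| = (3 * n)`! * gam n.

Import GRing.Theory.
Local Open Scope ring_scope.

(** The generating function of nonempty maps, truncated after degree [N]; truncation does not affect
    coefficients of its powers up to that degree. *)
Let Q : {poly nat} := \poly_(m < N.+1) beta m.

(** ['C(3 * j, i)] chooses the core edges that carry a map and [Q ^+ i] the maps they carry. In the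
    induction, [3 * j - i] vacant edges against [i.+1] slots is the recurrence of the binomial
    coefficient. *)
Lemma core_formula i n j : (0 < j)%N -> (n <= N)%N ->
  num_labelled_core (3 * n) j i = ((3 * n)`! * 'C(3 * j, i) * gam j * (('X^j * Q ^+ i : {poly nat})`_n)%R)%N.
Proof.
move=> j0; elim: i n => [|i IH] n nN.
  rewrite num_labelled_core0 expr0 mulr1 coefXn bin0 muln1 eqn_mul2l /=.
  case: eqP => [e|_]; last by rewrite muln0.
  by subst j; rewrite lab3E ?j0 ?muln1.
apply/eqP; rewrite -(eqn_pmul2l (ltn0Sn i)); apply/eqP.
have := insertion_count 'I_(3 * n) j i; rewrite card_ord => ->.
rewrite (sum_ord_mul3 (F := fun m =>
  'C(3 * n, m) * ((3 * j - i) * num_labelled_core (3 * n - m) j i * num_labelled m))%N); last first.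
  by move=> s /num_labelled_dvd ->; rewrite !muln0.
rewrite exprSr mulrA coefMr !big_distrr /=; apply: eq_bigr => -[m /= lm] _.
have mn : (m <= n)%N by [].
rewrite -mulnBr IH ?(leq_trans (leq_subr _ _)) // coef_poly.
rewrite (leq_ltn_trans mn) ?ltnS //.
have -> : num_labelled (3 * m) = ((3 * m)`! * beta m)%N.
  case: m lm mn => [|m] lm mn; first by rewrite num_labelled0 beta0 muln0.
  by rewrite labE // (leq_trans mn nN).
(* The choice of labels for the inserted map turns the factorials of both parts into the factorial
   of the whole, so the unlabelled counts satisfy an ordinary convolution. *)
have b1 : ('C(3 * n, 3 * m) * ((3 * m)`! * (3 * (n - m))`!) = (3 * n)`!)%N.
  by rewrite mulnBr bin_fact // leq_mul2l mn orbT.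
have b2 := mul_bin_left (3 * j) i.
rewrite -b1 -!mulnA [RHS]mulnCA; congr (_ * _)%N.
set x := _`_(n - m).
have -> : (i.+1 * ((3 * m)`! * ((3 * (n - m))`! * ('C(3 * j, i.+1) * (gam j * (x * beta m))))))%N =
   ((i.+1 * 'C(3 * j, i.+1)) * (3 * m)`! * (3 * (n - m))`! * gam j * x * beta m)%N.
  by clear; lia.
rewrite b2; clear; lia.
Qed.

(** Summing [core_formula] over the number [i] of slots is the binomial expansion of
    [(1 + Q) ^+ (3 * j)]. *)
Lemma beta_recurrence n : (0 < n <= N)%N ->
  beta n = (\sum_(1 <= j < n.+1) gam j * (('X^j * (1 + Q) ^+ (3 * j) : {poly nat})`_n)%R)%N.
Proof.
move=> /andP[n0 nN]; apply/eqP; rewrite -(eqn_pmul2l (fact_gt0 (3 * n))) -labE ?n0 //.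
rewrite num_labelled_sum big_distrr /=; apply/eqP; apply: eq_big_nat => j /andP[j1 _].
rewrite (eq_bigr (fun i : 'I_(3 * j).+1 =>
    (3 * n)`! * 'C(3 * j, i) * gam j * (('X^j * Q ^+ i : {poly nat})`_n)%R)%N); last first.
  by move=> i _; rewrite core_formula.
rewrite exprDn mulr_sumr coef_sum !big_distrr /=; apply: eq_bigr => i _.
rewrite expr1n mul1r mulrnAr coefMn.
have -> (x m : nat) : (x *+ m = x * m)%N by elim: m => [|m IH]; rewrite ?muln0 // mulrS IH mulnS.
by rewrite -!mulnA (mulnCA _ (gam j)) [('C(_, _) * _)%N]mulnC.
Qed.

End Solve.

(** * Vertex cuts and edge cuts *)

Section VertexCuts.
Variable T : finType.
Implicit Types (a b : {perm T}) (X Y P Q : {set T}) (rho : T).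

(* The subgraph induced on the vertices [(P, Q)] is connected. *)
Definition linked a b P Q : Prop :=
  forall X Y, closed_under a X -> closed_under b Y -> X \subset P -> Y \subset Q ->
    X :&: Q \subset Y -> Y :&: P \subset X -> (X != set0) || (Y != set0) ->
    X = P /\ Y = Q.

(* No set of vertices is separated from its complement by at most 2 edges. *)
Definition tight a b : Prop :=
  forall X Y, closed_under a X -> closed_under b Y ->
    (X != set0) || (Y != set0) -> (X != setT) || (Y != setT) ->
    2 < #|X :\: Y| + #|Y :\: X|.

Lemma tight_sym a b : tight a b -> tight b a.
Proof. by move=> t X Y aX bY h1 h2; rewrite addnC; apply: t; rewrite // orbC. Qed.

(** A set with few boundary edges or its complement avoids the black end of the root, and by
    [small_boundary] that one is a side of a 2-edge cut. *)
Lemma tight_no_away a b rho : planar_bicubic_on [set: T] a b rho ->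
  (forall X Y, ~~ away [set: T] a b rho X Y) -> tight a b.
Proof.
case/and5P=> hT ca cb _ hr no X Y aX bY n0 nT; rewrite ltnNge; apply/negP=> le.
have le1 : #|X :\: Y| <= 2 by apply: leq_trans (leq_addr _ _) le.
have le2 : #|Y :\: X| <= 2 by apply: leq_trans (leq_addl _ _) le.
have [rX|rX] := boolP (rho \in X); last first.
  have := small_boundary hT ca cb hr (subsetT X) (subsetT Y) aX bY rX n0 le1 le2 (leqW le).
  by apply/negP.
have e A B : ~: A :\: ~: B = B :\: A :> {set T} by rewrite !setDE setCK setIC.
have : away [set: T] a b rho (~: X) (~: Y).
  apply: (small_boundary hT ca cb hr); rewrite ?subsetT ?closed_underC ?e //.
  - by rewrite inE rX.
  - have f A : (~: A == set0 :> {set T}) = (A == setT) by rewrite -(inj_eq (@setC_inj _)) setCK setC0.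
    by rewrite !f.
  - by rewrite addnC leqW.
by apply/negP.
Qed.

(** Here [S] holds the edges at two vertices that are to be deleted. Three of these edges lead into
    the piece [(X, Y)], so one of the two vertices sends it at least two edges. Joining that vertex
    to the piece leaves at most [(3 - 2) + (3 - 2)] boundary edges. *)
Lemma tight_six a b X Y S : tight a b -> cubic_on [set: T] b ->
  closed_under a X -> closed_under b Y -> closed_under b S ->
  #|S| = 6 -> #|X :&: S| = 3 -> X :\: Y \subset S -> Y \subset X -> Y :&: S = set0 -> False.
Proof.
move=> t /forall_inP cb aX bY bS S6 XS XYS YX YS.
have [z zS] : exists z, z \in S by apply/card_gt0P; rewrite S6.
have bad w : closed_under b w -> w \subset S -> #|w| = 3 -> 1 < #|X :&: w| -> False.
  move=> bw wS w3 lt.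
  have X0 : X != set0 by apply/eqP=> e; move: XS; rewrite e set0I cards0.
  have XT : X != setT by apply/eqP=> e; move: XS; rewrite e setTI S6.
  have := t X (Y :|: w) aX (closed_underU bY bw); rewrite X0 XT => /(_ isT isT).
  have s1 : #|X :\: (Y :|: w)| <= #|X :&: S| - #|X :&: w|.
    have <- : #|X :&: S :\: X :&: w| = #|X :&: S| - #|X :&: w|.
      by rewrite cardsD (setIidPr (setIS X wS)).
    apply: subset_leq_card; apply/subsetP=> x; rewrite !inE negb_or => /andP[/andP[xY xw] xX].
    by rewrite xX xw /= (subsetP XYS) // inE xY.
  have s2 : #|(Y :|: w) :\: X| <= #|w| - #|X :&: w|.
    have <- : #|w :\: X :&: w| = #|w| - #|X :&: w| by rewrite cardsD (setIidPr (subsetIr X w)).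
    apply: subset_leq_card; apply/subsetP=> x; rewrite !inE => /andP[xX].
    by rewrite (negbTE xX) /=; case: (boolP (x \in Y)) => //= /(subsetP YX); rewrite (negbTE xX).
  move: s1 s2 lt; rewrite XS w3; clear; lia.
pose w := porbit b z; have w3 : #|w| = 3 by apply/eqP/cb.
have bw : closed_under b w by apply: closed_under_porbit.
have wS : w \subset S by apply: porbit_subset.
have [lt|le] := ltnP 1 #|X :&: w|; first exact: bad lt.
apply: (bad (S :\: w)); rewrite ?subsetDl ?closed_underD //.
  by rewrite cardsD (setIidPr wS) S6 w3.
have : #|X :&: S| = #|X :&: w| + #|X :&: (S :\: w)|.
  rewrite -(cardsID w (X :&: S)) -setIA (setIidPr wS) setDE -setIA -setDE //.
by move: le; rewrite XS; clear; lia.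
Qed.

(** If deleting at most two vertices separates [(X, Y)] from the rest [(X2, Y2)], each side has at
    least 3 boundary edges, all ending at deleted vertices. These have at most 6 edges, so each side
    gets exactly 3, and modulo 3 all of them end in one colour. If both sides use the same colour,
    [tight_six] applies; otherwise one side together with its deleted vertex has no boundary. *)
Lemma tight_linked a b P Q : tight a b -> cubic_on [set: T] a -> cubic_on [set: T] b ->
  closed_under a P -> closed_under b Q -> #|~: P| + #|~: Q| <= 6 -> linked a b P Q.
Proof.
move=> t ca cb aP bQ le X Y aX bY XP YQ XQY YPX n0.
set Sb := ~: P in le *; set Sw := ~: Q in le *.
pose X2 := P :\: X; pose Y2 := Q :\: Y.
have [e2|n2] := boolP ((X2 == set0) && (Y2 == set0)).
  by case/andP: e2; rewrite !setD_eq0 => h1 h2; split; apply/eqP; rewrite eqEsubset ?XP ?YQ.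
exfalso.
have XT : (X != setT) || (Y != setT).
  rewrite -negb_and; apply: contra n2 => /andP[/eqP eX /eqP eY].
  by rewrite /X2 /Y2 eX eY !setDT eqxx.
have inP x : x \in X -> x \in P by apply/subsetP.
have inQ x : x \in Y -> x \in Q by apply/subsetP.
have XQ x : x \in X -> x \in Q -> x \in Y by move=> h1 h2; apply: (subsetP XQY); rewrite inE h1.
have YP x : x \in Y -> x \in P -> x \in X by move=> h1 h2; apply: (subsetP YPX); rewrite inE h1.
have hb x : [&& (x \in X) ==> (x \in P), (x \in Y) ==> (x \in Q),
    (x \in X) && (x \in Q) ==> (x \in Y) & (x \in Y) && (x \in P) ==> (x \in X)].
  apply/and4P; split; apply/implyP=> //; first exact: inP.
  - exact: inQ.
  - by case/andP; apply: XQ.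
  - by case/andP; apply: YP.
have e1 : X :\: Y = X :&: Sw.
  apply/setP=> x; rewrite !inE; move: (hb x).
  by case: (x \in X); case: (x \in Y); case: (x \in P); case: (x \in Q).
have e3 : Y :\: X = Y :&: Sb.
  apply/setP=> x; rewrite !inE; move: (hb x).
  by case: (x \in X); case: (x \in Y); case: (x \in P); case: (x \in Q).
have e4 : X2 :\: Y2 = X2 :&: Sw.
  apply/setP=> x; rewrite !inE; move: (hb x).
  by case: (x \in X); case: (x \in Y); case: (x \in P); case: (x \in Q).
have e5 : Y2 :\: X2 = Y2 :&: Sb.
  apply/setP=> x; rewrite !inE; move: (hb x).
  by case: (x \in X); case: (x \in Y); case: (x \in P); case: (x \in Q).
have aX2 : closed_under a X2 by apply: closed_underD.
have bY2 : closed_under b Y2 by apply: closed_underD.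
have aSb : closed_under a Sb by apply: closed_underC.
have bSw : closed_under b Sw by apply: closed_underC.
have t1 := t _ _ aX bY n0 XT.
have t2 : 2 < #|X2 :\: Y2| + #|Y2 :\: X2|.
  apply: t => //; first by rewrite -negb_and.
  case/orP: n0 => /set0Pn[x xX]; apply/orP; [left|right]; apply/eqP=> /setP/(_ x); rewrite !inE xX //.
rewrite e1 e3 in t1; rewrite e4 e5 in t2.
have d0 (A B C : {set T}) : A :&: B = set0 -> #|A :&: C| + #|B :&: C| <= #|C|.
  move=> AB; rewrite -cardsUI -setIUl setIACA AB set0I cards0 addn0.
  exact: subset_leq_card (subsetIr _ _).
have XX2 : X :&: X2 = set0 by rewrite /X2 setDE setIC -setIA (setIC _ X) setICr setI0.
have YY2 : Y :&: Y2 = set0 by rewrite /Y2 setDE setIC -setIA (setIC _ Y) setICr setI0.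
have l1 := d0 _ _ Sw XX2; have l2 := d0 _ _ Sb YY2.
have div3 (A B : {set T}) : closed_under a A -> closed_under b B ->
    exists i j, #|A :\: B| + 3 * i = #|B :\: A| + 3 * j.
  move=> hA hB; have /dvdnP[i hi] := card_closed ca hA (subsetT _).
  have /dvdnP[j hj] := card_closed cb hB (subsetT _).
  exists j, i; have := cardsID B A; have := cardsID A B; rewrite (setIC B A) hi hj.
  clear; lia.
have [i1 [j1 m1]] := div3 _ _ aX bY; have [i2 [j2 m2]] := div3 _ _ aX2 bY2.
rewrite e1 e3 in m1; rewrite e4 e5 in m2.
have sum6 : #|Sb| + #|Sw| = 6 by move: le l1 l2 t1 t2; clear; lia.
have c1 : #|X :&: Sw| = 3 /\ #|Y :&: Sb| = 0 \/ #|X :&: Sw| = 0 /\ #|Y :&: Sb| = 3.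
  by move: le l1 l2 t1 t2 m1; clear; lia.
have c2 : #|X2 :&: Sw| = 3 /\ #|Y2 :&: Sb| = 0 \/ #|X2 :&: Sw| = 0 /\ #|Y2 :&: Sb| = 3.
  by move: le l1 l2 t1 t2 m2; clear; lia.
case: c1 => -[p q].
  have YX : Y \subset X by rewrite -setD_eq0 e3 -cards_eq0 q.
  have YSw : Y :&: Sw = set0 by apply/eqP; rewrite setI_eq0 -subsets_disjoint.
  case: c2 => -[p2 q2].
    have S6 : #|Sw| = 6 by move: l1 l2 sum6 le; rewrite p p2 q q2; clear; lia.
    by apply: (tight_six t cb aX bY bSw S6 p _ YX YSw); rewrite e1 subsetIr.
  (* One deleted vertex of each colour: all three edges of the white one lead into [X], so adding it
     to the piece leaves no boundary edge. *)
  have S3 : #|Sw| <= 3 by move: l1 l2 sum6 le; rewrite p p2 q q2; clear; lia.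
  have SX : Sw \subset X.
    by apply/setIidPr/eqP; rewrite eqEcard subsetIr p.
  have X0 : X != set0 by apply/eqP=> e; move: p; rewrite e set0I cards0.
  have XT' : X != setT.
    have /set0Pn[x] : Y2 :&: Sb != set0 by rewrite -card_gt0 q2.
    by rewrite inE => /andP[_ xS]; apply: contraTneq xS => eX; rewrite inE negbK inP // eX inE.
  have := t X (Y :|: Sw) aX (closed_underU bY bSw); rewrite X0 XT' => /(_ isT isT).
  have -> : X :\: (Y :|: Sw) = set0 by apply/eqP; rewrite setD_eq0 -subDset e1 subsetIr.
  have -> : (Y :|: Sw) :\: X = set0 by apply/eqP; rewrite setD_eq0 subUset YX.
  by rewrite cards0.
have XY : X \subset Y by rewrite -setD_eq0 e1 -cards_eq0 p.
have XSb : X :&: Sb = set0 by apply/eqP; rewrite setI_eq0 -subsets_disjoint.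
case: c2 => -[p2 q2]; last first.
  have S6 : #|Sb| = 6 by move: l1 l2 sum6 le; rewrite p p2 q q2; clear; lia.
  by apply: (tight_six (tight_sym t) ca bY aX aSb S6 q _ XY XSb); rewrite e3 subsetIr.
have S3 : #|Sb| <= 3 by move: l1 l2 sum6 le; rewrite p p2 q q2; clear; lia.
have SY : Sb \subset Y.
  by apply/setIidPr/eqP; rewrite eqEcard subsetIr q.
have Y0 : Y != set0 by apply/eqP=> e; move: q; rewrite e set0I cards0.
have YT' : Y != setT.
  have /set0Pn[x] : X2 :&: Sw != set0 by rewrite -card_gt0 p2.
  by rewrite inE => /andP[_ xS]; apply: contraTneq xS => eY; rewrite inE negbK inQ // eY inE.
have := t (X :|: Sb) Y (closed_underU aX aSb) bY; rewrite Y0 YT' !orbT => /(_ isT isT).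
have -> : Y :\: (X :|: Sb) = set0 by apply/eqP; rewrite setD_eq0 -subDset e3 subsetIr.
have -> : (X :|: Sb) :\: Y = set0 by apply/eqP; rewrite setD_eq0 subUset XY.
by rewrite cards0.
Qed.

(** Deleting the black ends of the two cut edges separates what is left of the side [(X, Y)]. As no
    white vertex is deleted, this piece is nonempty because [Y] is. Being everything would force [Y]
    and, by cardinality, [X] to be full, but [k] is not in [X]. *)
Lemma linked_no_away a b rho : planar_bicubic_on [set: T] a b rho ->
  (forall P Q, closed_under a P -> closed_under b Q -> #|~: P| + #|~: Q| <= 6 -> linked a b P Q) ->
  forall X Y, ~~ away [set: T] a b rho X Y.
Proof.
case/and5P=> hT ca cb _ hr lk X Y; apply/negP=> h.
have [X0 Y0] := away_neq0 h; have cXY := away_card h.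
case/and5P: h => _ _ aX bY /and3P[_ /cards1P[r er] /cards1P[k ek]].
pose S := porbit a r :|: porbit a k.
have aS : closed_under a S by apply: closed_underU; apply: closed_under_porbit.
have S6 : #|S| <= 6.
  move/forall_inP: ca => ca; have := ca r; have := ca k; rewrite !inE => /(_ isT)/eqP h1 /(_ isT)/eqP h2.
  by have := cardsUI (porbit a r) (porbit a k); rewrite h1 h2 /S; clear; lia.
have := lk (~: S) setT (closed_underC aS) (closed_underT _).
rewrite setCK setCT cards0 addn0 => /(_ S6) /(_ (X :\: S) Y).
case.
- exact: closed_underD.
- exact: bY.
- by rewrite setDE subsetIr.
- exact: subsetT.
- rewrite setIT; apply/subsetP=> x; rewrite inE => /andP[xS xX]; apply: contraT => xY.
  have : x \in X :\: Y by rewrite inE xY.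
  by rewrite er inE => /eqP e; rewrite e inE porbit_id in xS.
- apply/subsetP=> x; rewrite !in_setI in_setC => /andP[xY xS]; rewrite inE xS /=.
  apply: contraT => xX; have : x \in Y :\: X by rewrite inE xX.
  by rewrite ek inE => /eqP e; rewrite e inE porbit_id orbT in xS.
- by rewrite Y0 orbT.
move=> _ eY; have : k \in Y :\: X by rewrite ek inE.
rewrite inE => /andP[kX _]; case/negP: kX.
suff -> : X = setT by rewrite inE.
by apply/eqP; rewrite eqEcard subsetT cXY eY leqnn.
Qed.

End VertexCuts.

Lemma card_imset_eq (A B C : finType) (f : A -> B) (g : A -> C) (X : {set A}) :
  {in X &, forall x y, (f x == f y) = (g x == g y)} -> #|f @: X| = #|g @: X|.
Proof.
suff le (B' C' : finType) (f' : A -> B') (g' : A -> C') :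
    {in X &, forall x y, (f' x == f' y) = (g' x == g' y)} -> #|f' @: X| <= #|g' @: X|.
  by move=> e; apply/eqP; rewrite eqn_leq !le // => x y xX yX; rewrite e.
move=> e; have [->|/set0Pn[x0 x0X]] := eqVneq X set0; first by rewrite !imset0 !cards0.
pose F (c : C') := f' (odflt x0 [pick x in X | g' x == c]).
suff -> : f' @: X = F @: (g' @: X) by apply: leq_imset_card.
rewrite -imset_comp; apply: eq_in_imset => x xX; rewrite /F /=.
case: pickP => [y /andP[yX /eqP gy]|/(_ x)]; last by rewrite xX eqxx.
by apply/eqP; rewrite e // gy.
Qed.

(** * Rotation systems on darts *)

Section Darts.
Variables (T D : finType) (h : bool * T -> D) (a b : {perm T}) (rho : T) (m : rmap D).
Hypotheses (hI : injective h) (hS : forall y, exists p, h p = y).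
Hypotheses (hv0 : forall x, vperm m (h (false, x)) = h (false, a x))
           (hv1 : forall x, vperm m (h (true, x)) = h (true, b x))
           (he : forall c x, eperm m (h (c, x)) = h (~~ c, x)).
Implicit Types (X Y P Q : {set T}).

(** The two darts of an edge: [h0 x] leaves its black end, [h1 x] its white end. *)
Let h0 x := h (false, x).
Let h1 x := h (true, x).
Let h0I : injective h0. Proof. by move=> x y /hI[]. Qed.
Let h1I : injective h1. Proof. by move=> x y /hI[]. Qed.

Let vertex0 x : vertex m (h0 x) = h0 @: porbit a x.
Proof. by apply: (porbit_transport (closed_underT a)) => // y _; rewrite /h0 hv0. Qed.

Let vertex1 x : vertex m (h1 x) = h1 @: porbit b x.
Proof. by apply: (porbit_transport (closed_underT b)) => // y _; rewrite /h1 hv1. Qed.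

Let vertex00 x y : (vertex m (h0 x) == vertex m (h0 y)) = (porbit a x == porbit a y).
Proof. by rewrite !vertex0 (inj_eq (imset_inj h0I)). Qed.

Let vertex11 x y : (vertex m (h1 x) == vertex m (h1 y)) = (porbit b x == porbit b y).
Proof. by rewrite !vertex1 (inj_eq (imset_inj h1I)). Qed.

Let vertex01 x y : (vertex m (h0 x) == vertex m (h1 y)) = false.
Proof.
apply/negbTE/eqP=> /setP/(_ (h0 x)); rewrite vertex0 vertex1 imset_f ?porbit_id //.
by move=> /esym/imsetP[z _ /hI].
Qed.

Definition vertex_set X Y : {set {set D}} :=
  [set vertex m (h0 x) | x in X] :|: [set vertex m (h1 y) | y in Y].

Let vertex_setS X Y P Q : X \subset P -> Y \subset Q -> vertex_set X Y \subset vertex_set P Q.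
Proof. by move=> XP YQ; apply: setUSS; apply: imsetS. Qed.

Let in_vertex_set0 X Y x : closed_under a X -> (vertex m (h0 x) \in vertex_set X Y) = (x \in X).
Proof.
move=> aX; rewrite inE; apply/orP/idP => [[/imsetP[z zX /eqP]|/imsetP[z _ /eqP]]|xX].
- by rewrite vertex00 eq_porbit_mem => /(subsetP (porbit_subset aX zX)).
- by rewrite vertex01.
- by left; apply: imset_f.
Qed.

Let in_vertex_set1 X Y y : closed_under b Y -> (vertex m (h1 y) \in vertex_set X Y) = (y \in Y).
Proof.
move=> bY; rewrite inE; apply/orP/idP => [[/imsetP[z _ /eqP]|/imsetP[z zY /eqP]]|yY].
- by rewrite eq_sym vertex01.
- by rewrite vertex11 eq_porbit_mem => /(subsetP (porbit_subset bY zY)).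
- by right; apply: imset_f.
Qed.

Let dartP (y : D) : (exists x, y = h0 x) \/ (exists x, y = h1 x).
Proof. by case: (hS y) => -[[] x] <-; [right | left]; exists x. Qed.

Lemma vertices_set : vertices m = vertex_set setT setT.
Proof.
apply/setP=> A; apply/imsetP/setUP => [[y _ ->]|].
  by case: (dartP y) => -[x ->]; [left | right]; apply/imsetP; exists x.
by case=> /imsetP[x _ ->]; [exists (h0 x) | exists (h1 x)].
Qed.

Let sub_vertex_set (A : {set {set D}}) : A \subset vertices m ->
  exists X Y, [/\ closed_under a X, closed_under b Y & A = vertex_set X Y].
Proof.
move=> /subsetP sA; exists [set x | vertex m (h0 x) \in A], [set y | vertex m (h1 y) \in A]; split.
- apply/closed_underP=> x; rewrite !inE; congr (_ \in A); apply/eqP.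
  by rewrite vertex00 eq_porbit_mem (mem_porbit a 1).
- apply/closed_underP=> x; rewrite !inE; congr (_ \in A); apply/eqP.
  by rewrite vertex11 eq_porbit_mem (mem_porbit b 1).
apply/setP=> v; apply/idP/setUP => [vA|].
  have := sA v vA; rewrite vertices_set inE => /orP[]/imsetP[x _ e]; [left|right];
  by apply/imsetP; exists x; rewrite // inE -e.
by case=> /imsetP[x]; rewrite inE => xA ->.
Qed.

Let adj01 x : adjacent m (vertex m (h0 x)) (vertex m (h1 x)).
Proof. by apply/existsP; exists (h0 x); rewrite he !eqxx. Qed.

Let adj10 x : adjacent m (vertex m (h1 x)) (vertex m (h0 x)).
Proof. by apply/existsP; exists (h1 x); rewrite he !eqxx. Qed.

(** In one direction a set closed under adjacency contains every path starting in it; in the other,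
    [linked] is applied to the set of vertices reachable from [u]. *)
Lemma connected_linked P Q : closed_under a P -> closed_under b Q ->
  connected_on m (vertex_set P Q) <-> linked a b P Q.
Proof.
move=> aP bQ; split=> [/forall_inP con X Y aX bY XP YQ XQ YP n0 | lk].
  pose A := vertex_set X Y; pose W := vertex_set P Q.
  have clos u v : u \in A -> v \in W -> adjacent m u v -> v \in A.
    move=> uA vW /existsP[y /andP[/eqP eu /eqP ev]]; move: uA vW; rewrite eu ev.
    case: (dartP y) => -[x ->]; rewrite /h0 /h1 he /=.
      by rewrite in_vertex_set0 // !in_vertex_set1 // => xX xQ; apply: (subsetP XQ); rewrite inE xX.
    by rewrite in_vertex_set1 // !in_vertex_set0 // => xX xQ; apply: (subsetP YP); rewrite inE xX.
  have AW u : u \in A -> u \in W by apply/subsetP/vertex_setS.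
  have [u uA] : exists u, u \in A.
    case/orP: n0 => /set0Pn[x xX]; [exists (vertex m (h0 x)) | exists (vertex m (h1 x))].
      by rewrite in_vertex_set0.
    by rewrite in_vertex_set1.
  have all_ v : v \in W -> v \in A.
    move=> vW; have /connectP[p pth ->] := forall_inP (con u (AW u uA)) v vW.
    elim: p u uA pth => //= w p IH u uA /andP[/and3P[_ wW uw]]; apply: IH; exact: clos uw.
  split; apply/eqP; rewrite eqEsubset ?XP ?YQ /=; apply/subsetP=> x xP.
    by have := all_ (vertex m (h0 x)); rewrite !in_vertex_set0 //; apply.
  by have := all_ (vertex m (h1 x)); rewrite !in_vertex_set1 //; apply.
apply/forall_inP=> u uW; apply/forall_inP=> v vW.
set R := [rel _ _ | _]; pose A := [set w in vertex_set P Q | connect R u w].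
have AV : A \subset vertices m.
  apply/subsetP=> w; rewrite inE vertices_set => /andP[+ _].
  by apply/subsetP/vertex_setS; apply: subsetT.
have [X [Y [aX bY eA]]] := sub_vertex_set AV.
have inX x : (x \in X) = (vertex m (h0 x) \in A) by rewrite eA in_vertex_set0.
have inY x : (x \in Y) = (vertex m (h1 x) \in A) by rewrite eA in_vertex_set1.
have [] := lk X Y aX bY.
- by apply/subsetP=> x; rewrite inX inE in_vertex_set0 // => /andP[].
- by apply/subsetP=> x; rewrite inY inE in_vertex_set1 // => /andP[].
- apply/subsetP=> x; rewrite inE inX inY !inE -!/(vertex_set _ _) => /andP[/andP[xW con] xQ].
  have yW : vertex m (h1 x) \in vertex_set P Q by rewrite in_vertex_set1.
  rewrite inE in yW; rewrite yW /=; apply: connect_trans con (connect1 _).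
  by rewrite /= !inE xW yW adj01.
- apply/subsetP=> x; rewrite inE inX inY !inE -!/(vertex_set _ _) => /andP[/andP[xW con] xQ].
  have yW : vertex m (h0 x) \in vertex_set P Q by rewrite in_vertex_set0.
  rewrite inE in yW; rewrite yW /=; apply: connect_trans con (connect1 _).
  by rewrite /= !inE xW yW adj10.
- have : u \in A by rewrite inE uW connect0.
  rewrite eA inE => /orP[]/imsetP[x xX _]; apply/orP; [left|right]; apply/set0Pn; by exists x.
by move=> eX eY; move: vW; rewrite -eX -eY -eA inE => /andP[].
Qed.

Lemma card_vertex_set X Y : #|vertex_set X Y| = ncycles X a + ncycles Y b.
Proof.
rewrite cardsU (_ : _ :&: _ = set0) ?cards0 ?subn0; last first.
  apply/setP=> v; rewrite !inE; apply/negP=> /andP[/imsetP[x _ ->] /imsetP[y _ /eqP]].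
  by rewrite vertex01.
congr (_ + _); apply: card_imset_eq => x y _ _; [exact: vertex00 | exact: vertex11].
Qed.

(** At most two deleted vertices amount to at most 6 deleted edge ends, since all vertices have
    degree 3. *)
Lemma three_connected_linked : cubic_on [set: T] a -> cubic_on [set: T] b ->
  three_connected m <-> forall P Q, closed_under a P -> closed_under b Q ->
     #|~: P| + #|~: Q| <= 6 -> linked a b P Q.
Proof.
move=> ca cb; have eV P Q : closed_under a P -> closed_under b Q ->
    vertices m :\: vertex_set (~: P) (~: Q) = vertex_set P Q.
  move=> aP bQ; apply/setP=> v; rewrite in_setD vertices_set.
  apply/andP/idP => [[nv]|vW]; last first.
    split; last by apply: (subsetP (vertex_setS (subsetT P) (subsetT Q))).
    move: vW; rewrite [v \in vertex_set P Q]inE => /orP[]/imsetP[x xP ->].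
      by rewrite in_vertex_set0 ?closed_underC // inE negbK.
    by rewrite in_vertex_set1 ?closed_underC // inE negbK.
  rewrite inE => /orP[]/imsetP[x _ ev]; move: nv; rewrite ev.
    by rewrite !in_vertex_set0 ?closed_underC // inE negbK.
  by rewrite !in_vertex_set1 ?closed_underC // inE negbK.
have cS P Q : closed_under a P -> closed_under b Q ->
    (#|vertex_set (~: P) (~: Q)| < 3) = (#|~: P| + #|~: Q| <= 6).
  move=> aP bQ; rewrite card_vertex_set (card_closed_ncycles ca (closed_underC aP) (subsetT _)).
  rewrite (card_closed_ncycles cb (closed_underC bQ) (subsetT _)) -mulnDr ltnS.
  by rewrite -[6]/(3 * 2) leq_mul2l.
split=> [/forallP t P Q aP bQ le | lk].
  apply/connected_linked => //; rewrite -eV //; move/implyP: (t (vertex_set (~: P) (~: Q))); apply.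
  by rewrite cS // le andbT vertices_set; apply: vertex_setS; apply: subsetT.
apply/forallP=> S; apply/implyP=> /andP[sS lS].
have [X [Y [aX bY eS]]] := sub_vertex_set sS.
rewrite eS -(setCK X) -(setCK Y) eV ?closed_underC //; apply/connected_linked; rewrite ?closed_underC //.
by apply: lk; rewrite ?closed_underC // -cS ?closed_underC // !setCK -eS.
Qed.

Lemma transitive_linked : T -> transitive_on [set: T] a b <-> linked a b setT setT.
Proof.
move=> x0; split=> [/and3P[_ _ /forallP tr] X Y aX bY _ _ XY YX n0 | lk].
  have eXY : X = Y by move: XY YX; rewrite !setIT => h2 h3; apply/eqP; rewrite eqEsubset h2.
  subst Y; have := tr X; rewrite aX bY subsetT; move: n0; rewrite orbb => -> /eqP e.
  by split.
rewrite /transitive_on !closed_underT; apply/forallP=> Z; apply/implyP=> /and4P[aZ bZ _ Z0].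
by have [|||||-> _] := lk Z Z aZ bZ; rewrite ?subsetT ?setIT ?Z0.
Qed.

Lemma connected_transitive : T ->
  connected_on m (vertices m) <-> transitive_on [set: T] a b.
Proof.
move=> x0; rewrite vertices_set transitive_linked //; apply: connected_linked; exact: closed_underT.
Qed.

Lemma card_vertices : #|vertices m| = #|porbits a| + #|porbits b|.
Proof. by rewrite vertices_set card_vertex_set !ncycles_setT. Qed.

Lemma card_edges : #|edges m| = #|T|.
Proof.
have -> : edges m = (fun x => porbit (eperm m) (h0 x)) @: [set: T].
  apply/setP=> A; apply/imsetP/imsetP=> [[y _ ->]|[x _ ->]]; last by exists (h0 x).
  case: (dartP y) => -[x ->]; exists x => //; apply/eqP; rewrite eq_porbit_mem.
  have -> : h1 x = eperm m (h0 x) by rewrite he.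
  exact: (mem_porbit (eperm m) 1).
rewrite -cardsT.
have -> : #|[set: T]| = #|id @: [set: T]| by rewrite imset_id.
apply: card_imset_eq => x y _ _; apply/eqP/eqP=> [e|-> //].
have c : closed_under (eperm m) [set h0 y; h1 y].
  by apply: closed_under_sub => z; rewrite !inE => /orP[/eqP->|/eqP->]; rewrite he eqxx ?orbT.
have := subsetP (porbit_subset c (set21 _ _)) (h0 x); rewrite -e porbit_id => /(_ isT).
by rewrite !inE => /orP[]/eqP/hI[].
Qed.

(** The face permutation alternates between black and white darts, and its square acts on black
    darts as [b * a]. *)
Lemma card_faces : #|faces m| = #|porbits (b * a)|.
Proof.
set s := (eperm m * vperm m)%g; set p := (b * a)%g.
have s0 x : s (h0 x) = h1 (b x) by rewrite permM he hv1.
have s1 x : s (h1 x) = h0 (a x) by rewrite permM he hv0.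
have -> : faces m = (fun x => porbit s (h0 x)) @: [set: T].
  apply/setP=> A; apply/imsetP/imsetP=> [[y _ ->]|[x _ ->]]; last by exists (h0 x).
  case: (dartP y) => -[x ->]; first by exists x.
  exists (a x) => //; apply/eqP; rewrite eq_porbit_mem porbit_sym -s1.
  exact: (mem_porbit s 1).
rewrite -ncycles_setT; apply: card_imset_eq => x y _ _; rewrite !eq_porbit_mem.
have pE z : p z = a (b z) by rewrite permM.
clearbody s p.
apply/idP/idP=> [hx|/porbitP[i ->]]; last first.
  apply/porbitP; exists (2 * i); elim: i => [|i IH]; first by rewrite !perm1.
  by rewrite mulnS addnC addn2 !expgSr !permM -IH s0 s1 pE.
pose P := porbit p y; pose Z := h0 @: P :|: h1 @: (b @: P).
have c : closed_under s Z.
  apply: closed_under_sub => z; rewrite !inE => /orP[/imsetP[u uP ->]|/imsetP[_ /imsetP[u uP ->] ->]].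
    by rewrite s0 imset_f ?orbT ?imset_f.
  rewrite s1 imset_f // -pE.
  by rewrite (closed_underP _ _ (closed_under_porbit p y)).
have yZ : h0 y \in Z by rewrite inE imset_f ?porbit_id.
have := subsetP (porbit_subset c yZ) _ hx; rewrite inE => /orP[/imsetP[u uP /h0I -> //]|].
by move=> /imsetP[u _ /hI].
Qed.

End Darts.

Lemma double_count (A B : finType) (P : {set A}) (L : {set B}) (r : A -> B -> bool) k :
  {in P, forall p, #|[set M in L | r p M]| = 1} ->
  {in L, forall M, #|[set p in P | r p M]| = k} -> #|P| = #|L| * k.
Proof.
move=> h1 h2; rewrite -sum_nat_const -sum1_card.
transitivity (\sum_(p in P) \sum_(M in L) r p M).
  apply: eq_bigr => p pP; rewrite -(h1 p pP) -sum1_card big_mkcond [RHS]big_mkcond.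
  by apply: eq_bigr => M _; rewrite inE; case: (M \in L); case: (r p M).
rewrite exchange_big; apply: eq_bigr => M ML; rewrite -(h2 M ML) -sum1_card.
rewrite big_mkcond [RHS]big_mkcond; apply: eq_bigr => p _.
by rewrite inE; case: (p \in P); case: (r p M).
Qed.

(** * Edge labellings and dart labellings *)

Section Represent.
Variables (n : nat) (T : finType).
Hypothesis cT : #|T| = 3 * n.
Local Notation D := 'I_(6 * n).
Local Notation S := ({perm T} * {perm T} * T)%type.
Implicit Types (m : S) (M : rmap D) (h : {ffun bool * T -> D}).

Definition represents h m M : bool :=
  [forall x, [&& vperm M (h (false, x)) == h (false, m.1.1 x),
                 vperm M (h (true, x)) == h (true, m.1.2 x),
                 eperm M (h (false, x)) == h (true, x) &
                 eperm M (h (true, x)) == h (false, x)]] &&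
  (Defs.root M == h (false, m.2)).

Lemma representsP h m M : reflect
  [/\ forall x, vperm M (h (false, x)) = h (false, m.1.1 x),
      forall x, vperm M (h (true, x)) = h (true, m.1.2 x),
      forall c x, eperm M (h (c, x)) = h (~~ c, x) &
      Defs.root M = h (false, m.2)] (represents h m M).
Proof.
apply: (iffP andP) => [[/forallP e /eqP ->]|[e1 e2 e3 e4]].
  split=> // [x|x|c x]; case/and4P: (e x) => /eqP h1 /eqP h2 /eqP h3 /eqP h4 //.
  by case: c.
rewrite e4; split=> //; apply/forallP=> x.
by rewrite e1 e2 !e3 !eqxx.
Qed.

Lemma represent_surj h : injective h -> forall y, exists p, h p = y.
Proof.
move=> hI y; have : y \in codom h.
  by apply: inj_card_onto => //; rewrite card_prod card_bool cT card_ord; clear; lia.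
by case/codomP=> p ->; exists p.
Qed.

Lemma represents_labelled h m M : injective h -> represents h m M ->
  (M \in labelled_bicubic n) = (m \in labelled [set: T]).
Proof.
move=> hI /representsP[hv0 hv1 he hr]; have hS := represent_surj hI.
case: m hv0 hv1 hr => [[a b] rho] /= hv0 hv1 hr.
have cv := card_vertices hI hS hv0 hv1; have ce := card_edges hI hS he.
have cf := card_faces hI hS hv0 hv1 he.
have ct := connected_transitive hI hS hv0 hv1 he rho.
have h0I : injective (fun x => h (false, x)) by move=> x y /hI[].
have h1I : injective (fun x => h (true, x)) by move=> x y /hI[].
have v0 x : vertex M (h (false, x)) = (fun x => h (false, x)) @: porbit a x.
  by apply: (porbit_transport (h := fun x => h (false, x)) (closed_underT a)) => // y _; rewrite hv0.
have v1 x : vertex M (h (true, x)) = (fun x => h (true, x)) @: porbit b x.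
  by apply: (porbit_transport (h := fun x => h (true, x)) (closed_underT b)) => // y _; rewrite hv1.
have po (s : {perm T}) : perm_on [set: T] s by apply/subsetP.
rewrite inE [RHS]inE !po /=.
apply/and3P/and5P => [[/and3P[_ con /eqP eu] /andP[/forall_inP cub _] _]|[tr ca cb /eqP pl _]].
  split; rewrite ?inE //; first exact/ct.
  - apply/forall_inP=> x _; rewrite -(card_imset _ h0I) -v0; apply: cub; exact: imset_f.
  - apply/forall_inP=> x _; rewrite -(card_imset _ h1I) -v1; apply: cub; exact: imset_f.
  - by rewrite /planar_on !ncycles_setT cardsT -cv -cf -ce eu.
have cub : cubic M.
  apply/forall_inP=> A /imsetP[y _ ->]; have [[[] x] <-] := hS y.
    by rewrite -/(vertex M _) v1 card_imset //; apply: (forall_inP cb); rewrite inE.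
  by rewrite -/(vertex M _) v0 card_imset //; apply: (forall_inP ca); rewrite inE.
split.
- apply/and3P; split.
  + apply/forallP=> y; have [[c x] <-] := hS y; rewrite !he negbK eqxx andbT.
    by apply/eqP=> /hI[]; case: c.
  + exact/ct.
  + by rewrite cv cf ce; move: pl; rewrite !ncycles_setT cardsT => ->.
- rewrite /bicubic cub; apply/existsP.
  have [col c0 c1] : exists2 col : {ffun {set D} -> bool},
      (forall x, col (vertex M (h (false, x))) = true) & forall x, col (vertex M (h (true, x))) = false.
    exists [ffun A => [exists x, A == vertex M (h (false, x))]] => x; rewrite ffunE.
      by apply/existsP; exists x.
    apply/negbTE/existsPn => z; apply/eqP; rewrite v0 v1 => /setP/(_ (h (true, x))).
    by rewrite (imset_f (fun x => h (true, x))) ?porbit_id // => /esym/imsetP[w _ /hI].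
  exists col; apply/forallP=> y; have [[[] x] <-] := hS y; rewrite he /=; apply/eqP=> e.
    by have := etrans (etrans (esym (c1 x)) e) (c0 x).
  by have := etrans (etrans (esym (c0 x)) e) (c1 x).
- by have := cubic_card cub; rewrite card_ord -(eqn_pmul2l (isT : 0 < 3)) => <-; rewrite mulnA.
Qed.

(** Combines the two passages between vertex cuts and edge cuts: 3-connectedness is the absence of
    2-edge cuts, that is, of slots. *)
Lemma represents_three h m M : injective h -> represents h m M -> m \in labelled [set: T] ->
  three_connected M = (m \in labelled3 T).
Proof.
move=> hI /representsP[hv0 hv1 he hr] ml; have hS := represent_surj hI.
have g := labelled_bicubic_on ml; rewrite inE ml.
case/and5P: (g) => hT ca cb _ hrho.
have tl := three_connected_linked hI hS hv0 hv1 he ca cb.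
apply/idP/eqP => [/tl lk|s0].
  apply/setP=> k; rewrite !inE; apply/negP=> /andP[_ /existsP[X /existsP[Y /andP[h1 _]]]].
  by have /negP := linked_no_away g lk X Y.
apply/tl => P Q aP bQ le; apply: tight_linked => //.
by apply: (tight_no_away g); apply: (slots0_away hT ca cb hrho).
Qed.

Definition side_fun (a b : {perm T}) (p : bool * T) : bool * T :=
  (p.1, if p.1 then b p.2 else a p.2).

Lemma side_inj a b : injective (side_fun a b).
Proof. by move=> [[] x] [[] y] [] // /perm_inj ->. Qed.

Lemma flip_inj : injective (fun p : bool * T => (~~ p.1, p.2)).
Proof. by move=> [c x] [d y] [] /negb_inj -> ->. Qed.

Lemma represents_ex h m : injective h -> exists M, represents h m M.
Proof.
move=> hI; exists (extend hI (perm (@side_inj m.1.1 m.1.2)), extend hI (perm flip_inj), h (false, m.2)).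
apply/representsP; split=> // [x|x|c x]; rewrite [LHS]extendE permE //.
Qed.

Lemma represents_inj h m M M' : injective h ->
  represents h m M -> represents h m M' -> M = M'.
Proof.
move=> hI /representsP[a1 a2 a3 a4] /representsP[b1 b2 b3 b4].
have hS := represent_surj hI.
case: M a1 a2 a3 a4 => [[v e] r]; case: M' b1 b2 b3 b4 => [[v' e'] r'].
rewrite /vperm /eperm /Defs.root /= => b1 b2 b3 -> a1 a2 a3 ->.
have -> : v = v' by apply/permP=> y; have [[[] x] <-] := hS y; rewrite ?a1 ?a2 ?b1 ?b2.
by have -> : e = e' by apply/permP=> y; have [[c x] <-] := hS y; rewrite a3 b3.
Qed.

(** Comparison with the colour of the root vertex normalizes [c], which is determined only up to
    exchange of the two colours. *)
Definition black M (c : {ffun {set D} -> bool}) : {set D} :=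
  [set x | c (vertex M x) == c (vertex M (Defs.root M))].

Section Fibre.
Variables (M : rmap D) (c : {ffun {set D} -> bool}).
Hypotheses (hM : M \in labelled_bicubic n)
  (hc : forall x, c (vertex M x) != c (vertex M (eperm M x))).
Local Notation K := (black M c).

Let vK x : (vperm M x \in K) = (x \in K).
Proof.
rewrite !inE; congr (c _ == _); apply/eqP.
by rewrite eq_porbit_mem (mem_porbit (vperm M) 1).
Qed.

Let eK x : (eperm M x \in K) = (x \notin K).
Proof. by rewrite !inE; have := hc x; case: (c _); case: (c _); case: (c _). Qed.

Let eM x : eperm M x != x /\ eperm M (eperm M x) = x.
Proof.
by move: hM; rewrite inE => /and3P[/and3P[/forallP/(_ x)/andP[h1 /eqP h2] _ _] _ _].
Qed.

Let cardK : #|K| = #|T|.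
Proof.
have e : eperm M @: K = ~: K.
  apply/setP=> y; rewrite inE; apply/imsetP/idP => [[x xK ->]|yK].
    by rewrite eK negbK.
  by exists (eperm M y); rewrite ?eK // (proj2 (eM y)).
have := cardsC K; rewrite -e card_imset; last exact: perm_inj.
by rewrite card_ord cT; clear; lia.
Qed.

(** The edges whose [false] dart is in [K] are closed under both rotations and include the root, so
    by connectedness they are all edges. *)
Lemma represents_black h m : injective h -> represents h m M -> forall x, h (false, x) \in K.
Proof.
move=> hI hr; have ml := hM; rewrite (represents_labelled hI hr) in ml.
case/representsP: hr => hv0 hv1 he hr x.
case/and5P: (labelled_bicubic_on ml) => /and3P[_ _ /forallP tr] _ _ _ _.
pose Z := [set x | h (false, x) \in K].
have inZ z : (z \in Z) = (h (false, z) \in K) by rewrite in_set.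
have aZ : closed_under m.1.1 Z by apply/closed_underP=> z; rewrite inZ -hv0 vK inZ.
have e z : (h (false, z) \in K) = (h (true, z) \notin K).
  by have := eK (h (true, z)); rewrite (he true z).
have bZ : closed_under m.1.2 Z.
  by apply/closed_underP=> z; rewrite inZ e -hv1 vK -e inZ.
have Z0 : Z != set0 by apply/set0Pn; exists m.2; rewrite inZ -hr inE.
have := tr Z; rewrite aZ bZ Z0 subsetT => /eqP eZ.
by rewrite -inZ eZ inE.
Qed.

(** Reversal of darts extends a labelling of the black darts to the white ones; the rotation
    preserves colours, so the two edge permutations can be read off. *)
Lemma represents_exists (f : {ffun T -> D}) : injective f -> (forall x, f x \in K) ->
  exists h m, [/\ injective h, represents h m M & f = [ffun x => h (false, x)]].
Proof.
move=> fI fK; pose h := [ffun p : bool * T => if p.1 then eperm M (f p.2) else f p.2].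
have hI : injective h.
  move=> [[] x] [[] y]; rewrite !ffunE /=.
  - by move=> /perm_inj/fI ->.
  - by move=> e; have := fK y; rewrite -e eK fK.
  - by move=> e; have := fK x; rewrite e eK fK.
  - by move=> /fI ->.
have hS := represent_surj hI.
have hfull (s : {perm D}) : perm_on (h @: setT) s.
  by apply/subsetP=> y _; have [p <-] := hS y; apply: imset_f.
have [p ep] := extend_surj hI (hfull (vperm M)).
have hf x : h (false, x) \in K by rewrite [h _]ffunE fK.
have ht x : h (true, x) \notin K by rewrite [h _]ffunE /= eK negbK fK.
have hcK q : (h q \in K) = ~~ q.1.
  by case: q => -[] x /=; [apply/negbTE/ht | apply: hf].
have p1 q : (p q).1 = q.1.
  by have := vK (h q); rewrite {1}ep extendE !hcK => /negb_inj.
have pa : injective (fun x => (p (false, x)).2).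
  move=> x y e; have : p (false, x) = p (false, y).
    by rewrite [LHS]surjective_pairing [RHS]surjective_pairing !p1 e.
  by move=> /perm_inj[].
have pb : injective (fun x => (p (true, x)).2).
  move=> x y e; have : p (true, x) = p (true, y).
    by rewrite [LHS]surjective_pairing [RHS]surjective_pairing !p1 e.
  by move=> /perm_inj[].
have [rho er] : exists rho, Defs.root M = h (false, rho).
  have [[[] x] e] := hS (Defs.root M); last by exists x.
  by have := ht x; rewrite e inE eqxx.
exists h, (perm pa, perm pb, rho); split=> //; last by apply/ffunP=> x; rewrite !ffunE.
apply/representsP; split=> [x|x|d x|//].
- by rewrite ep extendE permE [in LHS](surjective_pairing (p (false, x))) p1.
- by rewrite ep extendE permE [in LHS](surjective_pairing (p (true, x))) p1.
- by rewrite !ffunE; case: d => //=; rewrite (proj2 (eM _)).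
Qed.

Lemma represents_det h h' m m' : injective h -> represents h m M -> represents h' m' M ->
  (forall x, h (false, x) = h' (false, x)) -> h = h' /\ m = m'.
Proof.
move=> hI /representsP[a1 a2 a3 a4] /representsP[b1 b2 b3 b4] e.
have ehh : h = h'.
  apply/ffunP=> -[[] x] //.
  by rewrite -[h (true, x)](a3 false) -[h' (true, x)](b3 false) e.
subst h'; split=> //; case: m a1 a2 a4 => [[a b] r]; case: m' b1 b2 b4 => [[a' b'] r'] /=.
move=> b1 b2 b4 a1 a2 a4.
have -> : a = a' by apply/permP=> x; have := a1 x; rewrite b1 => /hI[].
have -> : b = b' by apply/permP=> x; have := a2 x; rewrite b2 => /hI[].
by have -> : r = r' by move: a4; rewrite b4 => /hI[].
Qed.

Lemma card_fibre (G : {set S}) :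
  (forall h m, injective h -> represents h m M -> m \in G) ->
  #|[set p in setX [set h : {ffun bool * T -> D} | injectiveb h] G | represents p.1 p.2 M]| = #|T|`!.
Proof.
move=> hG; pose F (p : {ffun bool * T -> D} * S) := [ffun x => p.1 (false, x)].
rewrite -(card_in_imset (f := F)); last first.
  move=> [h m] [h' m'] /setIdP[/setXP[+ _] /= r1] /setIdP[_ /= r2] /ffunP e.
  rewrite inE => /injectiveP hI.
  have [x|-> -> //] := represents_det hI r1 r2.
  by have := e x; rewrite !ffunE.
have -> : #|T|`! = #|K| ^_ #|T| by rewrite cardK ffactnn.
rewrite -card_inj_ffuns_on; apply: eq_card => f; rewrite [RHS]inE.
apply/imsetP/andP => [[[h m] /setIdP[/setXP[+ _] r] ->]|[/ffun_onP fK /injectiveP fI]].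
  rewrite inE => /injectiveP hI; split.
    by apply/ffun_onP=> x; rewrite ffunE; apply: represents_black r _.
  by apply/injectiveP=> x y; rewrite !ffunE => /hI[].
have [h [m [hI r e]]] := represents_exists fI fK.
exists (h, m) => //; rewrite inE r andbT inE /= (hG h m) // andbT inE; exact/injectiveP.
Qed.

End Fibre.

(** Double counting of pairs [(h, m)]: there are [(6 * n)]![choices of]h[, each pair represents one
    dart map, and each dart map is represented by](3 * n)[!] pairs. *)
Lemma card_darts (G : {set S}) (L : {set rmap D}) : L \subset labelled_bicubic n ->
  (forall h m M, injective h -> represents h m M -> (M \in L) = (m \in G)) ->
  (6 * n)`! * #|G| = #|L| * (3 * n)`!.
Proof.
move=> sL hL; pose A := [set h : {ffun bool * T -> D} | injectiveb h].
have cA : #|A| = (6 * n)`!.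
  have := card_inj_ffuns (bool * T)%type D; rewrite card_prod card_bool cT card_ord mulnA => e.
  by rewrite -[RHS]ffactnn -e; apply: eq_card => f; rewrite !inE.
rewrite -cA -cardsX -cT; apply: (double_count (r := fun p M => represents p.1 p.2 M)).
  move=> [h m] /setXP[]; rewrite inE => /injectiveP hI mG /=.
  have [M r] := represents_ex m hI.
  apply/eqP/cards1P; exists M; apply/setP=> M'; rewrite !inE.
  apply/andP/eqP => [[_ r']|->]; first exact: represents_inj r' r.
  by rewrite (hL _ _ _ hI r).
move=> M ML; have hM := subsetP sL M ML.
have := hM; rewrite inE => /and3P[_ /andP[_ /existsP[c /forallP hc]] _].
by apply: (card_fibre hM hc) => h m hI r; rewrite -(hL _ _ _ hI r).
Qed.

End Represent.

(** * Isomorphism classes as orbits of relabelling *)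

Section Relabel.
Variable D : finType.
Implicit Types (M : rmap D) (g : {perm D}).

Definition relabel g M : rmap D :=
  ((vperm M ^ g)%g, (eperm M ^ g)%g, g (Defs.root M)).

Lemma isomorphicP M1 M2 : reflect (exists g, M2 = relabel g M1) (isomorphic M1 M2).
Proof.
apply: (iffP existsP) => -[g].
  move=> /and3P[/forallP h1 /forallP h2 /eqP h3]; exists g.
  case: M2 h1 h2 h3 => [[v e] r]; rewrite /vperm /eperm /Defs.root /= => h1 h2 <-.
  have -> : v = (vperm M1 ^ g)%g.
    by apply/permP=> y; rewrite -(permKV g y) permJ (eqP (h1 _)).
  have -> // : e = (eperm M1 ^ g)%g.
  by apply/permP=> y; rewrite -(permKV g y) permJ (eqP (h2 _)).
move=> ->; exists g; rewrite /relabel /vperm /eperm /Defs.root /= eqxx andbT.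
by apply/andP; split; apply/forallP=> x; rewrite permJ.
Qed.

Lemma relabel1 M : relabel 1 M = M.
Proof. by rewrite /relabel !conjg1 perm1; case: M => [[v e] r]. Qed.

Lemma relabelM g1 g2 M : relabel g2 (relabel g1 M) = relabel (g1 * g2) M.
Proof. by rewrite /relabel /vperm /eperm /Defs.root /= !conjgM permM. Qed.

Lemma isomorphic_equiv : equivalence_rel (@isomorphic D).
Proof.
have sym M1 M2 : isomorphic M1 M2 -> isomorphic M2 M1.
  move=> /isomorphicP[g ->]; apply/isomorphicP; exists (g^-1)%g.
  by rewrite relabelM mulgV relabel1.
have trans M1 M2 M3 : isomorphic M1 M2 -> isomorphic M2 M3 -> isomorphic M1 M3.
  move=> /isomorphicP[g ->] /isomorphicP[g' ->]; apply/isomorphicP; exists (g * g')%g.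
  by rewrite relabelM.
move=> M1 M2 M3; split; first by apply/isomorphicP; exists 1%g; rewrite relabel1.
by move=> h; apply/idP/idP; [apply: trans; apply: sym | apply: trans].
Qed.

(** The darts on which two relabellings with the same result agree include the root and are closed
    under both permutations. *)
Lemma relabel_inj M : (forall Z, closed_under (vperm M) Z -> closed_under (eperm M) Z ->
    Defs.root M \in Z -> Z = setT) -> injective (relabel^~ M).
Proof.
move=> con g g' [/permP ev /permP ee er].
pose Z := [set x | g x == g' x].
have cl (s : {perm D}) : (s ^ g =1 s ^ g')%g -> closed_under s Z.
  move=> e; apply: closed_under_sub => x; rewrite !inE => /eqP gx.
  by rewrite -permJ e gx permJ.
have eZ : Z = setT by apply: con; [exact: cl | exact: cl | rewrite inE er].
by apply/permP=> x; apply/eqP; have := in_setT x; rewrite -eZ inE.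
Qed.

(* Relabelling acts freely on connected rooted maps. *)
Lemma card_classes (S : {set rmap D}) :
  (forall M g, M \in S -> relabel g M \in S) ->
  (forall M, M \in S -> forall Z, closed_under (vperm M) Z -> closed_under (eperm M) Z ->
    Defs.root M \in Z -> Z = setT) ->
  #|S| = #|equivalence_partition (@isomorphic D) S| * #|D|`!.
Proof.
move=> hS con; apply: card_uniform_partition; last first.
  by apply: equivalence_partitionP => M1 M2 M3 _ _ _; apply: isomorphic_equiv.
move=> A /imsetP[M MS ->]; have -> : #|D|`! = #|{: {perm D}}|.
  rewrite -cardsT -(card_perm [set: D]); apply: eq_card => g; rewrite inE.
  by apply/subsetP.
rewrite -(card_imset _ (relabel_inj (con M MS))).
apply: eq_card => M'; rewrite inE; apply/andP/imsetP => [[_ /isomorphicP[g ->]]|[g _ ->]].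
  by exists g.
by split; [apply: hS | apply/isomorphicP; exists g].
Qed.

End Relabel.

Section Classes.
Variable n : nat.
Local Notation T := 'I_(3 * n).
Local Notation D := 'I_(6 * n).
Let cT : #|T| = 3 * n. Proof. exact: card_ord. Qed.

Lemma labelled_represents (M : rmap D) : M \in labelled_bicubic n ->
  exists (h : {ffun bool * T -> D}) m, injective h /\ represents h m M.
Proof.
move=> hM; have := hM; rewrite inE => /and3P[_ /andP[_ /existsP[c /forallP hc]] _].
have := card_fibre cT hM hc (G := setT) (fun _ _ _ _ => in_setT _).
move=> e; have : 0 < #|T|`! by apply: fact_gt0.
rewrite -e => /card_gt0P[[h m]]; rewrite inE => /andP[/setXP[+ _] r].
by rewrite inE => /injectiveP hI; exists h, m.
Qed.

Lemma represents_relabel (h : {ffun bool * T -> D}) m M (g : {perm D}) :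
  represents h m M -> represents [ffun p => g (h p)] m (relabel g M).
Proof.
move=> /representsP[h1 h2 h3 h4]; apply/representsP; split=> [x|x|c x|].
- by rewrite !ffunE permJ h1.
- by rewrite !ffunE permJ h2.
- by rewrite !ffunE permJ h3.
- by rewrite !ffunE -h4.
Qed.

Lemma card_bicubic_classes (G : {set {perm T} * {perm T} * T}) (L : {set rmap D}) :
  L \subset labelled_bicubic n ->
  (forall (h : {ffun bool * T -> D}) m M, injective h -> represents h m M -> (M \in L) = (m \in G)) ->
  #|G| = (3 * n)`! * #|equivalence_partition (@isomorphic D) L|.
Proof.
move=> sL hL; have := card_darts cT sL hL; rewrite card_classes.
- rewrite card_ord => e; apply/eqP; rewrite -(eqn_pmul2l (fact_gt0 (6 * n))) e.
  by rewrite -[X in X == _]mulnA [X in X == _]mulnC [X in _ == X]mulnA.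
- move=> M g ML; have [h [m [hI r]]] := labelled_represents (subsetP sL M ML).
  have r' := represents_relabel g r.
  rewrite (hL _ _ _ _ r') -?(hL _ _ _ hI r) //.
  by move=> x y; rewrite !ffunE => /perm_inj/hI.
move=> M ML Z vZ eZ rZ; have [h [m [hI r]]] := labelled_represents (subsetP sL M ML).
have := subsetP sL M ML; rewrite (represents_labelled cT hI r) => /labelled_bicubic_on.
case/and5P=> /and3P[_ _ /forallP tr] _ _ _ _.
have hS := represent_surj cT hI; case/representsP: r => h1 h2 h3 h4.
pose Z' := [set x | h (false, x) \in Z].
have inZ x : (x \in Z') = (h (false, x) \in Z) by rewrite in_set.
have e x : (h (true, x) \in Z) = (h (false, x) \in Z).
  by have := closed_underP _ _ eZ (h (false, x)); rewrite (h3 false).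
have aZ : closed_under m.1.1 Z'.
  by apply/closed_underP=> x; rewrite !inZ -h1 (closed_underP _ _ vZ).
have bZ : closed_under m.1.2 Z'.
  by apply/closed_underP=> x; rewrite !inZ -e -h2 (closed_underP _ _ vZ) e.
have Z0 : Z' != set0 by apply/set0Pn; exists m.2; rewrite inZ -h4.
have := tr Z'; rewrite aZ bZ Z0 subsetT => /eqP eT.
apply/setP=> y; have [[c x] <-] := hS y; rewrite in_setT.
by have := in_setT x; rewrite -eT inZ; case: c => //; rewrite e.
Qed.

Lemma num_labelled_bicubic : num_labelled (3 * n) = (3 * n)`! * #|bicubic_maps n|.
Proof.
apply: (card_bicubic_classes (G := labelled [set: T]) (L := labelled_bicubic n)) => // h m M hI r.
exact: (represents_labelled cT hI r).
Qed.

Lemma card_labelled3 : #|labelled3 T| = (3 * n)`! * g n.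
Proof.
apply: card_bicubic_classes => [|h m M hI r].
  by apply/subsetP=> M; rewrite inE => /andP[].
rewrite inE (represents_labelled cT hI r).
have [ml|ml] := boolP (m \in labelled _); first by rewrite (represents_three cT hI r ml).
by rewrite inE (negbTE ml).
Qed.

End Classes.

(** * Coloured Dyck paths *)

(** Paths and colour lists live in infinite types, so their finite sets are counted through
    duplicate-free enumerations. *)
Definition has_card (A : eqType) (P : pred A) (k : nat) : Prop :=
  exists s : seq A, [/\ uniq s, s =i P & size s = k].

Section HasCard.
Variables (A B : eqType).
Implicit Types (P Q : pred A).

Lemma has_card_eq P Q k : P =1 Q -> has_card P k -> has_card Q k.
Proof. by move=> e [s [us sP ss]]; exists s; split=> // x; rewrite sP; apply: e. Qed.

Lemma has_card0 P : P =1 pred0 -> has_card P 0.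
Proof. by move=> e; exists [::]; split=> // x; rewrite [RHS]e. Qed.

Lemma has_cardU P Q k l : has_card P k -> has_card Q l ->
  (forall x, P x -> ~~ Q x) -> has_card (fun x => P x || Q x) (k + l).
Proof.
move=> [s [us sP <-]] [t [ut tQ <-]] d; exists (s ++ t); rewrite size_cat; split=> //.
  rewrite cat_uniq us ut andbT; apply/hasPn=> x; rewrite tQ sP => Qx.
  by apply/negP=> /d; rewrite -[Q x]/(x \in Q) Qx.
by move=> x; rewrite mem_cat sP tQ.
Qed.

Lemma has_card_map P (Q : pred B) (f : A -> B) k : injective f ->
  (forall y, reflect (exists2 x, P x & y = f x) (Q y)) -> has_card P k -> has_card Q k.
Proof.
move=> fI fQ [s [us sP <-]]; exists (map f s); rewrite map_inj_uniq // size_map; split=> // y.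
apply/mapP/idP => [[x xs ->]|/fQ[x Px ->]].
  by apply/fQ; exists x => //; rewrite -[P x]/(x \in P) -sP.
by exists x; rewrite // sP.
Qed.

Lemma has_card_prod (P : pred A) (Q : pred B) k l : has_card P k -> has_card Q l ->
  has_card (fun x => P x.1 && Q x.2) (k * l).
Proof.
move=> [s [us sP <-]] [t [ut tQ <-]]; exists [seq (x, y) | x <- s, y <- t].
rewrite size_allpairs; split=> //; first by apply: allpairs_uniq => // -[x y] [].
move=> [x y]; rewrite /in_mem /=; apply/allpairsP/andP => [[[x' y'] /= [xs yt [-> ->]]]|[xs yt]].
  by split; [rewrite -[P x']/(x' \in P) -sP | rewrite -[Q y']/(y' \in Q) -tQ].
by exists (x, y); rewrite sP tQ.
Qed.

Lemma has_card_sum (Q : pred A) (key : A -> nat) (k : nat -> nat) n :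
  (forall j, j < n -> has_card (fun x => (key x == j) && Q x) (k j)) ->
  has_card (fun x => (key x < n) && Q x) (\sum_(j < n) k j).
Proof.
elim: n => [|n IH] h; first by rewrite big_ord0; apply: has_card0.
rewrite big_ord_recr /=; apply: has_card_eq (has_cardU (IH _) (h n _) _) => //.
- by move=> x /=; rewrite -andb_orl orbC -leq_eqVlt.
- by move=> j jn; apply: h; apply: leqW.
- by move=> x /andP[lt _]; rewrite negb_and (ltn_eqF lt).
Qed.

End HasCard.

Lemma has_card_ltn k : has_card (fun c => c < k) k.
Proof. by exists (iota 0 k); rewrite iota_uniq size_iota; split=> // c; rewrite mem_iota. Qed.

Lemma has_card_bijective (A : finType) (B : eqType) (E : {set A}) (P : pred B) :
  has_card P #|E| -> exists f : {x | x \in E} -> {y | P y}, bijective f.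
Proof.
move=> [s [us sP ss]].
pose t : seq {y | P y} := pmap insub s.
have ts : map val t = s.
  rewrite pmap_filter; last exact: insubK.
  by apply/all_filterP/allP=> x; rewrite sP => Px; rewrite isSome_insub.
have ut : uniq t by rewrite -(map_inj_uniq val_inj) ts.
have tT y : y \in t by rewrite -(mem_map val_inj) ts sP; apply: (valP y).
have st : size t = #|{: {x | x \in E}}| by rewrite card_sig -ss -ts size_map.
have lt (x : {x | x \in E}) : enum_rank x < size t by rewrite st.
have lt' y : index y t < #|{: {x | x \in E}}| by rewrite -st index_mem.
exists (fun x => tnth (in_tuple t) (Ordinal (lt x))).
exists (fun y => enum_val (Ordinal (lt' y))) => [x|y].
  apply: (canLR enum_rankK); apply: val_inj; rewrite /=.
  by rewrite (tnth_nth (tnth (in_tuple t) (Ordinal (lt x)))) index_uniq.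
by rewrite (tnth_nth y) /= enum_valK /= nth_index.
Qed.

Fixpoint stays_above (h : nat) (w : seq bool) : bool :=
  match w with
  | [::] => true
  | true :: w' => stays_above h.+1 w'
  | false :: w' => (0 < h) && stays_above h.-1 w'
  end.

Lemma stays_aboveE h w :
  all (fun k => count_mem false (take k w) <= h + count_mem true (take k w))
      (iota 0 (size w).+1) = stays_above h w.
Proof.
elim: w h => [|x w IH] h; first by [].
rewrite [size (x :: w)]/=; set n := (size w).+1 in IH *.
have n0 : 0 < n by []; clearbody n.
rewrite -[iota 0 n.+1]/(0 :: iota (1 + 0) n) iotaDl [all _ (_ :: _)]/= all_map.
case: x => /=.
  by rewrite -IH; apply: eq_all => k /=; rewrite add0n add1n addnS addSn.
case: h => [|h] /=; last first.
  by rewrite -IH; apply: eq_all => k /=; rewrite add0n add1n addSn.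
by case: n n0 {IH} => //= n _; rewrite take0.
Qed.

(** [p] is the step preceding [w]; [ascents] is the case [p = false]. The parameter makes recursion
    on [w] possible. *)
Definition ascents_after (p : bool) (w : seq bool) : seq nat :=
  [seq index false (drop i w) |
     i <- iota 0 (size w) & nth false w i && ~~ nth false (p :: w) i].

Lemma ascents_after_cons p x w : ascents_after p (x :: w) =
  (if x && ~~ p then [:: index false (x :: w)] else [::]) ++ ascents_after x w.
Proof.
rewrite /ascents_after [size (x :: w)]/= -[iota 0 _.+1]/(0 :: iota (1 + 0) (size w)) iotaDl.
by rewrite [filter _ (_ :: _)]/= filter_map; case: (x && ~~ p); rewrite /= -map_comp.
Qed.

Lemma ascents_false w : ascents (false :: w) = ascents w.
Proof. exact: ascents_after_cons. Qed.

Lemma ascents_true k w : ascents (nseq k.+1 true ++ false :: w) = k.+1 :: ascents w.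
Proof.
have i (j : nat) : index false (nseq j true ++ false :: w) = j by elim: j => //= j ->.
have e (j : nat) : ascents_after true (nseq j true ++ false :: w) = ascents w.
  by elim: j => [|j IH]; rewrite /= ascents_after_cons.
by rewrite -[LHS]/(ascents_after false _) /= ascents_after_cons /= e i.
Qed.

(* A coloured path from height [h] down to 0 with [3 * m] up-steps, following a
   down-step. *)
Definition colored_suffix (h m : nat) (p : seq bool * seq nat) : bool :=
  [&& count_mem true p.1 == 3 * m, count_mem false p.1 == h + 3 * m, stays_above h p.1,
      all (dvdn 3) (ascents p.1) &
      all2 (fun a c => c < g (a %/ 3)) (ascents p.1) p.2].

Lemma colored_dyck_suffix n p : colored_dyck n p = colored_suffix 0 n p.
Proof.
rewrite /colored_dyck /colored_suffix /dyck -stays_aboveE -!andbA add0n.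
have e : size p.1 = count_mem true p.1 + count_mem false p.1.
  by rewrite -(count_predC (pred1 true)); congr (_ + _); apply: eq_count => -[].
have e' x y : (x + y == 2 * (3 * n)) && (x == y) = (x == 3 * n) && (y == 3 * n).
  by apply/andP/andP => -[/eqP h1 /eqP h2]; split; apply/eqP; move: h1 h2; clear; lia.
by rewrite e andbA e' -andbA.
Qed.

Lemma colored_suffix_nil h m cs :
  colored_suffix h m ([::], cs) = [&& h == 0, m == 0 & cs == [::]].
Proof.
rewrite /colored_suffix /=; apply/and3P/and3P => [[/eqP h1 /eqP h2 h3]|[/eqP-> /eqP-> /eqP->] //].
by case: cs h3 => // _; split; rewrite //; apply/eqP; move: h1 h2; clear; lia.
Qed.

Lemma colored_suffix_down h m w cs :
  colored_suffix h m (false :: w, cs) = (0 < h) && colored_suffix h.-1 m (w, cs).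
Proof.
rewrite /colored_suffix /= ascents_false; case: h => [|h] /=; first by rewrite !andbF.
by rewrite add0n add1n addSn eqSS.
Qed.

(** The down-step ending the ascent is removed with it, hence the new height [h + k] and not
    [h + k.+1]; what remains again follows a down-step. *)
Lemma colored_suffix_up h m k w cs :
  colored_suffix h m (nseq k.+1 true ++ false :: w, cs) =
  [&& 3 %| k.+1, k.+1 <= 3 * m & if cs is c :: cs' then
      (c < g (k.+1 %/ 3)) && colored_suffix (h + k) (m - k.+1 %/ 3) (w, cs')
    else false].
Proof.
rewrite /colored_suffix [(_, cs).1]/= [(_, cs).2]/= ascents_true.
have sa : stays_above h (nseq k.+1 true ++ false :: w) = stays_above (h + k) w.
  elim: k h => [|k IH] h; first by rewrite /= addn0.
  by rewrite -[LHS]/(stays_above h.+1 (nseq k.+1 true ++ false :: w)) IH addnS addSn.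
have ct : count_mem true (nseq k.+1 true ++ false :: w) = k.+1 + count_mem true w.
  by rewrite count_cat count_nseq mul1n.
have cf : count_mem false (nseq k.+1 true ++ false :: w) = (count_mem false w).+1.
  by rewrite count_cat count_nseq.
rewrite sa ct cf; case: cs => [|c cs]; first by rewrite !andbF.
rewrite [all _ (_ :: _)]/= [all2 _ _ _]/=.
have [/dvdnP[j ej]|] := boolP (3 %| k.+1); last by rewrite !andbF.
rewrite ej mulnK // andTb [j * 3]mulnC leq_mul2l /=.
have ek : k = (3 * j).-1 by rewrite mulnC -ej.
have [jm|mj] := leqP j m; last first.
  by apply/negbTE/negP=> /andP[/eqP e _]; move: e mj; clear; lia.
have -> : (3 * j + count_mem true w == 3 * m) = (count_mem true w == 3 * (m - j)).
  by apply/eqP/eqP; move: jm; clear; lia.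
have -> : ((count_mem false w).+1 == h + 3 * m) = (count_mem false w == h + k + 3 * (m - j)).
  by apply/eqP/eqP; move: jm ej; clear; lia.
move: (count_mem true w == _) (count_mem false w == _) (stays_above _ _) (all _ _).
by move: (all2 _ _ _) (c < _) => [] [] [] [] [] [].
Qed.

Lemma split_ascent (w : seq bool) : [\/ w = [::], exists w', w = false :: w',
  exists k w', w = nseq k.+1 true ++ false :: w' | exists k, w = nseq k.+1 true].
Proof.
elim: w => [|[] w IH]; first by constructor 1.
- case: IH => [->|[w' ->]|[k [w' ->]]|[k ->]].
  + by constructor 4; exists 0.
  + by constructor 3; exists 0, w'.
  + by constructor 3; exists k.+1, w'.
  + by constructor 4; exists k.+1.
- by constructor 2; exists w.
Qed.

Lemma colored_suffix_all_up h m k cs : colored_suffix h m (nseq k.+1 true, cs) = false.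
Proof.
rewrite /colored_suffix /= !count_nseq; apply/negbTE/negP=> /and3P[/eqP h1 /eqP h2 _].
by move: h1 h2; clear; lia.
Qed.

(** * Counting coloured paths by height and number of up-steps *)

Section Recurrence.
Variables (N : nat) (X : nat -> nat -> nat).
Hypothesis XE : forall h m, m <= N -> X h m =
  ((h == 0) && (m == 0)) + (if h is h'.+1 then X h' m else 0) +
  \sum_(j < m) g j.+1 * X (h + 3 * j + 2) (m - j.+1).

Let starts (x : bool) (p : seq bool * seq nat) := ohead p.1 == Some x.

Lemma has_card_up h m : m <= N ->
  (forall m' h', m' < m -> has_card (colored_suffix h' m') (X h' m')) ->
  has_card (fun p => starts true p && colored_suffix h m p)
    (\sum_(j < m) g j.+1 * X (h + 3 * j + 2) (m - j.+1)).
Proof.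
(* Paths are sorted by their first ascent, of length [3 * j.+1]; the following down-step leaves
   height [h + 3 * j + 2]. *)
move=> mN IH; pose key (p : seq bool * seq nat) := (index false p.1 %/ 3).-1.
pose Q p := starts true p && colored_suffix h m p.
have ind (j : nat) w : index false (nseq j true ++ false :: w) = j by elim: j => //= j ->.
apply: (@has_card_eq _ (fun p => (key p < m) && Q p)).
  move=> [w cs]; rewrite /Q; case: (boolP (starts true _ && _)) => [|_]; last by rewrite andbF.
  case: (split_ascent w) => [->|[w' ->]|[k [w' ->]]|[k ->]] //; last by rewrite colored_suffix_all_up andbF.
  rewrite colored_suffix_up => /and4P[_ /dvdnP[j e] le _].
  by rewrite andbT /key ind e mulnK //; move: e le; clear; lia.
apply: (has_card_sum (k := fun j => g j.+1 * X (h + 3 * j + 2) (m - j.+1))) => j jm.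
pose f (x : nat * (seq bool * seq nat)) := (nseq (3 * j.+1) true ++ false :: x.2.1, x.1 :: x.2.2).
apply: (has_card_map (f := f))
  (has_card_prod (has_card_ltn (g j.+1)) (IH (m - j.+1) (h + 3 * j + 2) _));
  last by move: jm; clear; lia.
  move=> [c [w cs]] [c' [w' cs']] [] /eqP.
  by rewrite eqseq_cat // eqxx => /eqP[->] -> ->.
move=> y; apply: (iffP andP) => [|[[c [w' cs']] /andP[/= cg cf] ->]].
  case: y => [w cs] [kj /andP[st]].
  case: (split_ascent w) st kj => [->|[w' ->]|[k [w' ->]]|[k ->]] //; last by rewrite colored_suffix_all_up.
  rewrite colored_suffix_up /key ind => _ kj /and3P[/dvdnP[i e] le].
  case: cs => // c cs'; rewrite e mulnK // in kj * => /andP[cg cf].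
  have ij : i = j.+1 by move: kj e; clear; case: i => // i; rewrite [_.-1]/= => /eqP ->.
  subst i; exists (c, (w', cs')); last by rewrite /f [3 * _]mulnC -e.
  rewrite /= cg; congr (colored_suffix _ _ _): cf.
  by move: e; clear; lia.
have e3 : 3 * j.+1 = (3 * j + 2).+1 by clear; lia.
rewrite /f e3 /key ind -e3 mulKn // eqxx /Q; split=> //; apply/andP; split.
  by rewrite e3.
rewrite e3 colored_suffix_up -e3 mulKn // dvdn_mulr // leq_mul2l jm cg addnA.
by [].
Qed.

(** An ascent raises [h] but lowers [m], and a down-step lowers [h] at the same [m]; hence strong
    induction on [m] with an inner induction on [h]. *)
Lemma has_card_suffix h m : m <= N -> has_card (colored_suffix h m) (X h m).
Proof.
elim/ltn_ind: m h => m IHm; elim=> [|h IHh] mN; rewrite XE //.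
  pose P0 (p : seq bool * seq nat) := (m == 0) && (p == ([::], [::])).
  apply: (@has_card_eq _ (fun p => (P0 p || pred0 p) || (starts true p && colored_suffix 0 m p))).
    move=> [w cs]; rewrite /P0 /= orbF.
    case: (split_ascent w) => [->|[w' ->]|[k [w' ->]]|[k ->]].
    - by rewrite colored_suffix_nil eqxx orbF.
    - by rewrite colored_suffix_down andbF.
    - by rewrite andbF.
    - by rewrite colored_suffix_all_up !andbF.
  apply: (has_cardU (P := fun p => P0 p || pred0 p)
    (Q := fun p => starts true p && colored_suffix 0 m p)); last 2 first.
  - by apply: has_card_up => // m' h' lt; apply: IHm => //; apply: ltnW (leq_trans lt mN).
  - by move=> p; rewrite /= orbF => /andP[_ /eqP ->].
  apply: (has_cardU (P := P0) (Q := pred0)) => //; last exact: has_card0.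
  rewrite eqxx /P0; case: (m == 0); last exact: has_card0.
  by exists [:: ([::], [::])]; split=> // x; rewrite inE.
pose P1 p := starts false p && colored_suffix h.+1 m p.
apply: (@has_card_eq _ (fun p => P1 p || (starts true p && colored_suffix h.+1 m p))).
  move=> [w cs]; rewrite /P1.
  case: (split_ascent w) => [->|[w' ->]|[k [w' ->]]|[k ->]].
  - by rewrite colored_suffix_nil.
  - by rewrite orbF.
  - by [].
  - by rewrite colored_suffix_all_up !andbF.
rewrite [h.+1 == 0]/= andFb add0n.
apply: (has_cardU (P := P1) (Q := fun p => starts true p && colored_suffix h.+1 m p)); last 2 first.
- by apply: has_card_up => // m' h' lt; apply: IHm => //; apply: ltnW (leq_trans lt mN).
- by move=> [[|[] w] cs] //.
apply: (has_card_map (f := fun p => (false :: p.1, p.2)) _ _ (IHh mN)).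
  by move=> [w cs] [w' cs'] [-> ->].
move=> [w cs]; apply: (iffP andP) => [[]|[[w' cs'] h' [-> ->]]]; last first.
  by rewrite colored_suffix_down.
case: w => [|[] w] // _; rewrite colored_suffix_down => h'.
by exists (w, cs).
Qed.

End Recurrence.

(** * Powers of the generating function *)

Section Series.
Import GRing.Theory.
Local Open Scope ring_scope.

(** The witness for height [h] is [C ^+ h.+1]: a path descending from height [h] to 0 splits at its
    first passages to lower levels into [h.+1] independent excursions. *)
Lemma has_card_dyck (N : nat) (C : {poly nat}) :
  (C`_0)%R = 1%N ->
  (forall n, 0 < n <= N ->
    (C`_n)%R = (\sum_(1 <= j < n.+1) g j * (('X^j * C ^+ (3 * j))`_n)%R)%N)%N ->
  has_card (colored_dyck N) (C`_N)%R.
Proof.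
move=> C0 CE.
apply: (has_card_eq (fun p => esym (colored_dyck_suffix N p))).
have := has_card_suffix (N := N) (X := fun h m => (C ^+ h.+1)`_m) _ 0 (leqnn N).
rewrite expr1; apply=> h m mN.
pose Y j : {poly nat} := 'X^(j.+1) * C ^+ (3 * j.+1).
have CE' i : (i < m)%N -> C`_i.+1 = (\sum_(j < m) g j.+1 * ((Y j)`_i.+1)%R)%N.
  move=> im; rewrite CE ?(leq_trans im mN) // big_add1 /= big_mkord.
  (* The range of [j] is enlarged so that it no longer depends on [i]; the new terms vanish because
     [Y j] has no coefficient below degree [j.+1]. *)
  rewrite (big_ord_widen m (fun j => g j.+1 * ((Y j)`_i.+1)%R)%N) //.
  rewrite [RHS](bigID (fun j : 'I_m => (j < i.+1)%N)) /= [X in (_ + X)%N]big1 ?addn0 //.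
  by move=> j; rewrite -leqNgt => ij; rewrite /Y coefXnM ltnS ij muln0.
(* The constant term of the last factor [C] leaves [C ^+ h], which accounts for the empty path or an
   initial down-step; its higher terms are expanded by the equation for [C]. *)
rewrite exprSr coefMr big_ord_recl subn0 C0 mulr1.
have -> : (C ^+ h)`_m = ((h == 0) && (m == 0) + (if h is h'.+1 then ((C ^+ h'.+1)`_m)%R else 0))%N.
  by case: h => [|h] //=; rewrite expr0 coef1 addn0; case: (m == 0)%N.
congr (_ + _)%N.
transitivity (\sum_(i < m) \sum_(j < m) g j.+1 * ((C ^+ h)`_(m - i.+1) * (Y j)`_i.+1)).
  apply: eq_bigr => i _; rewrite lift0 CE' // big_distrr /=.
  by apply: eq_bigr => j _; apply: mulnCA.
rewrite exchange_big; apply: eq_bigr => j _; rewrite -big_distrr /=; congr (_ * _)%N.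
have -> : C ^+ (h + 3 * j + 2).+1 = C ^+ h * C ^+ (3 * j.+1).
  by rewrite -exprD; congr (_ ^+ _); clear; lia.
transitivity ((C ^+ h * Y j)`_m).
  rewrite coefMr big_ord_recl /Y [X in _ = (_ * X + _)%R]coefXnM /= mulr0 add0r.
  by apply: eq_bigr.
by rewrite /Y mulrCA coefXnM ltnS leqNgt ltn_ord.
Qed.

End Series.

Theorem theorem3p2 (n : nat) (hn : 1 <= n) :
  exists f : {M : {set rmap 'I_(6 * n)} | M \in bicubic_maps n} ->
             {p : seq bool * seq nat | colored_dyck n p},
    bijective f.
Proof.
(* [beta] counts nonempty maps only; the constant term 1 of [C] stands for an edge that carries no
   map. *)
pose beta m := if m == 0 then 0 else #|bicubic_maps m|.
pose C : {poly nat} := (1 + \poly_(m < n.+1) beta m)%R.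
have CE m : m <= n -> (C`_m)%R = (m == 0) + beta m.
  by move=> mn; rewrite /C coefD coef1 coef_poly ltnS mn; case: (m == 0).
apply: has_card_bijective.
have -> : #|bicubic_maps n| = (C`_n)%R by rewrite CE // /beta eqn0Ngt hn.
apply: has_card_dyck => [|m /andP[m0 mn]]; first by rewrite CE.
rewrite CE // eqn0Ngt m0 add0n.
apply: (beta_recurrence (N := n)) => [//|k /andP[k0 _]|k /andP[k0 _]|].
- by rewrite num_labelled_bicubic /beta eqn0Ngt k0.
- exact: card_labelled3.
by rewrite m0.
Qed.
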